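(* Let $\{\omega_x\}_{x\in\mathbb{Z}^2}$ be i.i.d. exponential random variables with rate $1$. The following statement holds with probability one: for each $i\in\{1,2\}$ and each $x\in\mathbb{Z}_{\ge0}^2$, the path $\{x_k=x+ke_i\}_{k\in\mathbb{Z}_{\ge0}}$ is the only semi-infinite geodesic $\{x_k\}_{k\in\mathbb{Z}_{\ge 0}}$ that satisfies $x_0=x$ and $\liminf_{k\to\infty}k^{-1}x_k\cdot e_{3-i}=0$.
   Context: $e_1=(1,0)$, $e_2=(0,1)$. For $x\le y$ coordinatewise in $\mathbb{Z}^2$, $\Pi_{x,y}$ is the set of nearest-neighbor up-right paths $(x_k)_{k=0}^n$ from $x$ to $y$, $n=|y-x|_1$, $x_{k+1}-x_k\in\{e_1,e_2\}$, and $G_{x,y}=\max_{(x_k)\in\Pi_{x,y}}\sum_{k=0}^{|y-x|_1}\omega_{x_k}$. The (almost surely unique) maximizing path is the geodesic between $x$ and $y$. A semi-infinite geodesic is a nearest-neighbor up-right path $\{x_k\}_{k\in\mathbb{Z}_{\ge0}}$ ($x_{k+1}-x_k\in\{e_1,e_2\}$) such that for all $0\le m<n$ the segment $(x_k)_{k=m}^n$ is the geodesic between $x_m$ and $x_n$. *)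

(* Defs.v *)
From HB Require Import structures.
From mathcomp Require Import all_boot all_order all_algebra.
From mathcomp Require Import all_classical all_reals all_analysis.
From mathcomp Require Import zify.

Set Implicit Arguments.
Unset Strict Implicit.
Unset Printing Implicit Defensive.

Import Order.TTheory GRing.Theory Num.Theory.

Local Open Scope classical_set_scope.
Local Open Scope ring_scope.

(* The lattice Z^2, with its componentwise additive group structure. *)
Local Notation Z2 := (int * int)%type.

(* basis_vec 1 = (1, 0) and basis_vec 2 = (0, 1); other indices are unused. *)
Definition basis_vec (i : nat) : Z2 := ((i == 1%N)%:Z, (i == 2%N)%:Z).

Definition dot (x y : Z2) : int := x.1 * y.1 + x.2 * y.2.

Definition upright_step (x y : Z2) : bool :=
  (y - x == basis_vec 1) || (y - x == basis_vec 2).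

(* A finite path is the sequence of all its vertices, endpoints included. The
   length |y - x|_1 is forced by the steps, and the set is empty unless x <= y
   coordinatewise. *)
Definition upright_paths (x y : Z2) : set (seq Z2) :=
  [set s | exists p : seq Z2,
      [/\ s = x :: p, path upright_step x p & last x p = y]].

Section LastPassage.
Context {R : realType}.
Implicit Types (w : Z2 -> R) (x y : Z2) (s : seq Z2) (g : nat -> Z2).

Definition passage_time w s : R := \sum_(z <- s) w z.

(* For x <= y this supremum is a maximum: see last_passage_time_max. *)
Definition last_passage_time w x y : R :=
  sup [set passage_time w s | s in upright_paths x y].

Definition is_geodesic w x y s : Prop :=
  upright_paths x y s /\ passage_time w s = last_passage_time w x y.

Definition path_segment g (m n : nat) : seq Z2 :=
  [seq g k | k <- iota m (n - m).+1].

Definition semi_infinite_geodesic w g : Prop :=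
  (forall k, upright_step (g k) (g k.+1)) /\
  (forall m n : nat, (m < n)%N ->
     is_geodesic w (g m) (g n) (path_segment g m n)).

End LastPassage.

Section IIDExponential.
Context d (T : measurableType d) (R : realType) (P : probability T R).

Definition mutually_independent (I : choiceType) (X : I -> {RV P >-> R}) : Prop :=
  forall (J : seq I) (B : I -> set R), uniq J ->
    (forall j, measurable (B j)) ->
    P (\bigcap_(j in [set` J]) (X j @^-1` B j)) =
    (\prod_(j <- J) P (X j @^-1` B j))%E.

Definition has_exponential_law (rate : R) (X : {RV P >-> R}) : Prop :=
  forall B : set R, measurable B -> distribution P X B = exponential_prob rate B.

Definition iid_exponential (I : choiceType) (rate : R) (X : I -> {RV P >-> R})
    : Prop :=
  mutually_independent X /\ (forall i, has_exponential_law rate (X i)).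

End IIDExponential.

Section MaximumAttained.

Let enum_paths := fix F (n : nat) (x : Z2) : seq (seq Z2) :=
  if n is n'.+1 then
    map (cons x) (F n' (x + basis_vec 1) ++ F n' (x + basis_vec 2))
  else [:: [:: x]].

Let mem_enum_paths x p :
  path upright_step x p -> x :: p \in enum_paths (size p) x.
Proof.
elim: p x => [|y p IH] x /=; first by rewrite inE.
case/andP=> xy /IH yp; apply: map_f; rewrite mem_cat.
have E v : y - x = v -> y = x + v by move=> <-; rewrite addrC subrK.
by case/orP: xy => /eqP/E <-; rewrite yp ?orbT.
Qed.

Let size_upright x p : path upright_step x p ->
  (size p)%:Z = (last x p).1 - x.1 + ((last x p).2 - x.2).
Proof.
elim: p x => [|y p IH] x /=; first by rewrite !subrr.
case/andP=> xy /IH yp.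
have : y.1 - x.1 + (y.2 - x.2) = 1.
  by case/orP: xy => /eqP; case: x y {yp} => [a b] [a' b'] [] /= -> ->.
move: yp; lia.
Qed.

Let upright_paths_nonempty (x y : Z2) : x.1 <= y.1 -> x.2 <= y.2 ->
  upright_paths x y !=set0.
Proof.
case: x y => [a b] [a' b'] /= aa' bb'.
have [m ->] : exists m : nat, a' = a + m%:Z by exists `|a' - a|%N; lia.
have [n ->] : exists n : nat, b' = b + n%:Z by exists `|b' - b|%N; lia.
move=> {a' b' aa' bb'}.
elim: m a => [|m IH] a; last first.
  have [s [p [_ pp lp]]] := IH (a + 1).
  exists ((a, b) :: (a + 1, b) :: p), ((a + 1, b) :: p); split => //=.
    by rewrite pp andbT; apply/orP; left; apply/eqP; congr pair => /=; lia.
  by rewrite lp; congr pair; lia.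
elim: n b => [|n IH] b.
  by exists [:: (a, b)], [::]; split => //=; rewrite !addr0.
have [s [p [_ pp lp]]] := IH (b + 1).
exists ((a, b) :: (a, b + 1) :: p), ((a, b + 1) :: p); split => //=.
  by rewrite pp andbT; apply/orP; right; apply/eqP; congr pair => /=; lia.
by rewrite lp; congr pair; lia.
Qed.

Lemma last_passage_time_max (R : realType) (w : Z2 -> R) (x y : Z2) :
  x.1 <= y.1 -> x.2 <= y.2 ->
  (exists s, is_geodesic w x y s) /\
  (forall s, upright_paths x y s -> passage_time w s <= last_passage_time w x y).
Proof.
move=> xy1 xy2; have [s0 s0P] := upright_paths_nonempty xy1 xy2.
set N := `|(y.1 - x.1 + (y.2 - x.2))%R|%N.
have sub s : upright_paths x y s -> s \in enum_paths N x.
  move=> [p [-> pp lp]]; have := size_upright pp; rewrite lp /N => <-.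
  exact: mem_enum_paths.
pose L := [seq s <- enum_paths N x | `[< upright_paths x y s >]].
have LP s : (s \in L) <-> upright_paths x y s.
  rewrite mem_filter; split=> [/andP[/asboolP//]|H].
  by rewrite (sub _ H) andbT; apply/asboolP.
have [s sL smax] : exists2 s, s \in L &
    forall t, t \in L -> passage_time w t <= passage_time w s.
  have : s0 \in L by apply/LP.
  elim: (L) s0 {s0P} => // a l IH s0 _.
  case: l IH => [_|b l IH].
    by exists a; rewrite ?inE// => t; rewrite inE => /eqP ->.
  have [s sl smax] := IH b (mem_head _ _).
  have [le|/ltW le] := leP (passage_time w a) (passage_time w s).
    by exists s; [rewrite inE sl orbT | move=> t; rewrite inE => /orP[/eqP->|/smax]].
  exists a; first exact: mem_head.
  by move=> t; rewrite inE => /orP[/eqP->//|/smax] /le_trans; apply.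
have sP : upright_paths x y s by apply/LP.
have ub : ubound [set passage_time w t | t in upright_paths x y] (passage_time w s).
  by move=> _ [t tP <-]; apply/smax/LP.
have E : passage_time w s = last_passage_time w x y.
  apply/eqP; rewrite eq_le; apply/andP; split.
    by apply: ub_le_sup; [exists (passage_time w s) | exists s].
  by apply: ge_sup => //; exists (passage_time w s), s.
split; first by exists s.
by move=> t tP; rewrite -E; apply/smax/LP.
Qed.

End MaximumAttained.

(* Main.v *)
Require Import Defs.
From HB Require Import structures.
From mathcomp Require Import all_boot all_order all_algebra.
From mathcomp Require Import all_classical all_reals all_analysis.
From mathcomp Require Import measurable_realfun.
From mathcomp Require Import lra ring zify.

Set Implicit Arguments.
Unset Strict Implicit.
Unset Printing Implicit Defensive.

Import Order.TTheory GRing.Theory Num.Theory.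
Import numFieldTopology.Exports.
Local Open Scope classical_set_scope.
Local Open Scope ring_scope.

(** The direction e_1 is discussed; the other one is the same after exchanging
the coordinates. A horizontal ray is a semi-infinite geodesic because it
contains the only up-right path between any two of its points.

Conversely, let a semi-infinite geodesic with liminf slope 0 make an upward
step at some site y. For infinitely many of its later sites z, whose height
above y is a small fraction of their horizontal distance to y, the geodesic
from y to z starts upward, that is G(y + e_1, z) <= G(y + e_2, z). So it
suffices that almost surely, for every y, some thin cone
  [y + (a, b) with N <= a, 0 < b and q b <= a]
contains no such z. This is [ae_goes_right]; as there are countably many y, it
is stated with y at the origin.

The cone is handled by comparison with a stationary model. Fix a small be > 0
and a large rectangle, enlarge the weights on the row just above it to rate
1 - be and on the column just to its right to rate be, and let L(z) be the
passage time from z to the far corner. By Burke's theorem ([burke_box]) the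
increments of L along the bottom row are again independent with rate 1 - be,
and L(0, 0) - L(0, 1) has rate be. The point is that a single field L can be
compared with all the sites z of the cone simultaneously, so that no union
bound is paid for the comparison itself. Planarity gives, for z = (a, b), the
alternative of [exit_dichotomy]:
- the optimal path from e_1 to the corner leaves [0, a] x [0, b] through the
  top, and then L(e_1) - L(e_2) <= G(e_1, z) - G(e_2, z);
- it leaves through the right side, and then the sum of a increments of L along
  the bottom row is at most G(e_1, z).
The second case is exponentially unlikely in a, by [exponential_tails]: the sum
is about a / (1 - be), whereas G(e_1, z) stays below (1 + be / 2) a in a thin
cone, because few paths lead to z. This is summable over the cone. Outside of
it, a bad z forces L(e_1) <= L(e_2), which means that L(0, 0) - L(0, 1) is equal
to the weight at the origin; this is unlikely because an exponential variable
of rate be is typically large. Together this is [goes_up_bound]; the bound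
vanishes when be tends to 0 and N to infinity.

Burke's theorem is obtained by replacing one site at a time. There the two
increments I and J entering a site of weight W become W + (I - J)^+ and
W + (J - I)^+, and W is replaced by min(I, J). Memorylessness makes min(I, J)
an exponential variable of rate 1, independent of I - J ([min_diff_indep]).
Thus I - J, min(I, J) and W are independent, and the replacement merely
exchanges the last two, which have the same law: it preserves the joint law of
the whole family ([indep_exp_flip]). *)

(** * Independent families and the sigma-algebras they generate *)

Section Independence.
Context d (T : measurableType d) (R : realType) (P : probability T R).

Lemma indep_dynkin (G : set (set T)) (B : set T) :
  G `<=` measurable -> setI_closed G -> measurable B ->
  (forall A, G A -> P (A `&` B) = P A * P B)%E ->
  forall A, <<s G >> A -> (P (A `&` B) = P A * P B)%E.
Proof.
move=> Gm GI mB indG A.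
pose D := [set A | measurable A /\ (P (A `&` B) = P A * P B)%E].
suff : <<s G >> `<=` D by move=> GD /GD[].
rewrite -setI_closed_g_dynkin_g_sigma_algebra//; apply: smallest_sub; last first.
  by move=> C GC; split; [exact: Gm|exact: indG].
have finP C : measurable C -> P C \is a fin_num by exact: fin_num_measure.
split.
- by split => //; rewrite setTI probability_setT mul1e.
- move=> C [mC indC]; split; first exact: measurableC.
  have -> : ~` C `&` B = B `\` C by rewrite setDE setIC.
  rewrite measureD//; last by rewrite ltey_eq finP.
  rewrite [X in (_ - X)%E](_ : _ = P C * P B)%E; last by rewrite setIC; exact: indC.
  rewrite probability_setC//.
  by rewrite muleBl ?mul1e// ?fin_num_adde_defr// finP.
- move=> F tF DF.
  have mF n : measurable (F n) by case: (DF n).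
  split; first exact: bigcupT_measurable.
  rewrite setI_bigcupl measure_bigcup//=; last 2 first.
  + by move=> n _; exact: measurableI.
  + by under eq_fun do rewrite setIC; exact: trivIset_setIl.
  rewrite measure_bigcup//=.
  under eq_eseriesr do rewrite (DF _).2 muleC.
  by rewrite -(fineK (finP _ mB)) nneseriesZl// muleC.
Qed.

Lemma indep_generated (G H : set (set T)) :
  G `<=` measurable -> H `<=` measurable ->
  setI_closed G -> setI_closed H ->
  (forall A B, G A -> H B -> P (A `&` B) = P A * P B)%E ->
  forall A B, <<s G >> A -> <<s H >> B -> (P (A `&` B) = P A * P B)%E.
Proof.
move=> Gm Hm GI HI ind A B GA HB.
have mA : measurable A.
  exact: (smallest_sub (@sigma_algebra_measurable _ T) Gm).
rewrite setIC muleC; move: B HB; apply: indep_dynkin => // B HB.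
rewrite setIC muleC; move: A GA {mA}; apply: indep_dynkin => //; first exact: Hm.
by move=> A GA; exact: ind.
Qed.

Section Family.
Variable I : choiceType.
Implicit Types (X : I -> T -> R) (J K : set I).

Definition indep_family X :=
  (forall i, measurable_fun setT (X i)) /\
  forall (s : seq I) (B : I -> set R), uniq s -> (forall i, measurable (B i)) ->
  (P (\bigcap_(i in [set` s]) (X i @^-1` B i)) =
   \prod_(i <- s) P (X i @^-1` B i))%E.

(** A pi-system generating the sigma-algebra of the coordinates in [J]. *)
Definition cylinders X J : set (set T) :=
  [set A | exists s B, [/\ uniq s, [set` s] `<=` J,
     forall i, measurable (B i) & A = \bigcap_(i in [set` s]) (X i @^-1` B i)]].

Lemma cylinders_measurable X J : (forall i, measurable_fun setT (X i)) ->
  cylinders X J `<=` measurable.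
Proof.
move=> mX _ [s [B [_ _ mB ->]]].
rewrite bigcap_seq; apply: bigsetI_measurable => i _.
by rewrite -[X in measurable X]setTI; exact: mX.
Qed.

Lemma generated_measurable X J : (forall i, measurable_fun setT (X i)) ->
  <<s cylinders X J >> `<=` measurable.
Proof.
move=> mX; apply: (smallest_sub (@sigma_algebra_measurable _ T)).
exact: cylinders_measurable.
Qed.

Lemma cylindersI X J : setI_closed (cylinders X J).
Proof.
move=> _ _ [s [B [us sJ mB ->]]] [t [C [ut tJ mC ->]]].
pose D i := (if i \in s then B i else setT) `&` (if i \in t then C i else setT).
exists (undup (s ++ t)), D; split.
- exact: undup_uniq.
- by move=> i /=; rewrite mem_undup mem_cat => /orP[/sJ|/tJ].
- by move=> i; apply: measurableI; case: ifP.
- apply/seteqP; split => x /=.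
    move=> [xB xC] i /=; rewrite mem_undup mem_cat => _; rewrite /D; split.
      by case: ifP => // /xB.
    by case: ifP => // /xC.
  move=> xD; split => i /= Hi; have /= := xD i.
    by rewrite mem_undup mem_cat Hi => /(_ isT)[]; rewrite Hi.
  by rewrite mem_undup mem_cat Hi orbT => /(_ isT)[_]; rewrite Hi.
Qed.

Lemma indep_cylinders X J K A B : indep_family X -> J `&` K = set0 ->
  cylinders X J A -> cylinders X K B -> (P (A `&` B) = P A * P B)%E.
Proof.
move=> [mX ind] JK [s [C [us sJ mC ->]]] [t [D [ut tK mD ->]]].
have sNt i : i \in t -> i \notin s.
  move=> it; apply/negP => is_; have : (J `&` K) i by split; [exact: sJ|exact: tK].
  by rewrite JK.
pose E i := if i \in s then C i else D i.
have mE i : measurable (E i) by rewrite /E; case: ifP.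
have -> : \bigcap_(i in [set` s]) (X i @^-1` C i) = \bigcap_(i in [set` s]) (X i @^-1` E i).
  by apply: eq_bigcapr => i /= Hi; rewrite /E Hi.
have -> : \bigcap_(i in [set` t]) (X i @^-1` D i) = \bigcap_(i in [set` t]) (X i @^-1` E i).
  by apply: eq_bigcapr => i /= /sNt/negbTE Hi; rewrite /E Hi.
rewrite -bigcap_setU.
have -> : [set` s] `|` [set` t] = [set` s ++ t].
  apply/seteqP; split=> i /=; first by rewrite mem_cat => -[|] ->; rewrite ?orbT.
  by rewrite mem_cat => /orP.
rewrite !ind// ?big_cat// cat_uniq us ut andbT.
by apply/hasPn.
Qed.

(** Functions of disjoint groups of coordinates are independent: on cylinders
this is the product formula, and cylinders form pi-systems. *)
Lemma indep_grouping X J K A B : indep_family X -> J `&` K = set0 ->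
  <<s cylinders X J >> A -> <<s cylinders X K >> B ->
  (P (A `&` B) = P A * P B)%E.
Proof.
move=> iX JK; apply: indep_generated.
- by apply: cylinders_measurable; case: iX.
- by apply: cylinders_measurable; case: iX.
- exact: cylindersI.
- exact: cylindersI.
- by move=> {}A {}B; exact: indep_cylinders.
Qed.

(** [f] is a measurable function of the coordinates in [J]; stated as
measurability over the generated sigma-algebra, so that the closure properties
of measurable functions apply to it. *)
Definition known_by X J (f : T -> R) :=
  measurable_fun [set: g_sigma_algebraType (cylinders X J)] f.

Lemma known_coord X J i : J i -> known_by X J (X i).
Proof.
move=> Ji _ B mB; rewrite setTI; apply: sub_sigma_algebra.
exists [:: i], (fun=> B); split => //=.
  by move=> j /=; rewrite inE => /eqP ->.
by rewrite bigcap_seq big_seq1.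
Qed.

Lemma known_measurable X J f : (forall i, measurable_fun setT (X i)) ->
  known_by X J f -> measurable_fun setT f.
Proof. by move=> mX kf _ B mB; apply: (generated_measurable mX); exact: kf. Qed.

End Family.

Definition indep_pair (f g : T -> R) := forall A B : set R,
  measurable A -> measurable B ->
  (P (f @^-1` A `&` g @^-1` B) = P (f @^-1` A) * P (g @^-1` B))%E.

Lemma indep_pair_known (I : choiceType) (X : I -> T -> R) J K f g :
  indep_family X -> J `&` K = set0 -> known_by X J f -> known_by X K g ->
  indep_pair f g.
Proof.
move=> iX JK kf kg A B mA mB; apply: (indep_grouping iX JK).
  by have := kf measurableT A mA; rewrite setTI.
by have := kg measurableT B mB; rewrite setTI.
Qed.

(** Both sides are measures on the plane which agree on rectangles. *)
Lemma indep_pair_law (X Y : {RV P >-> R}) : indep_pair X Y ->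
  forall E : set (R * R), measurable E ->
  ((distribution P X \x distribution P Y) E = P [set t | E (X t, Y t)])%E.
Proof.
move=> ind E mE.
have mXY : measurable_fun setT (fun t => (X t, Y t)).
  by apply: measurable_fun_pair.
pose XY : {mfun T >-> (R * R)%type} := HB.pack (fun t => (X t, Y t))
  (isMeasurableFun.Build _ _ _ _ _ mXY).
by apply: (product_measure_unique (m' := distribution P XY)).
Qed.

Lemma indep_pair_same_law (f g h : T -> R) :
  measurable_fun setT f -> measurable_fun setT g -> measurable_fun setT h ->
  indep_pair f g -> indep_pair f h ->
  (forall B, measurable B -> P (g @^-1` B) = P (h @^-1` B)) ->
  forall E : set (R * R), measurable E ->
  P [set t | E (f t, g t)] = P [set t | E (f t, h t)].
Proof.
move=> mf mg mh fg fh gh E mE.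
pose F : {mfun T >-> R} := HB.pack f (isMeasurableFun.Build _ _ _ _ _ mf).
pose G : {mfun T >-> R} := HB.pack g (isMeasurableFun.Build _ _ _ _ _ mg).
pose H : {mfun T >-> R} := HB.pack h (isMeasurableFun.Build _ _ _ _ _ mh).
rewrite -(@indep_pair_law F G)//.
have mFH : measurable_fun setT (fun t => (f t, h t)).
  by apply: measurable_fun_pair.
pose FH : {mfun T >-> (R * R)%type} := HB.pack (fun t => (f t, h t))
  (isMeasurableFun.Build _ _ _ _ _ mFH).
apply: (product_measure_unique (m' := distribution P FH)) => // A B mA mB.
by rewrite [LHS]fh// -gh.
Qed.

(** Tonelli's theorem for the product of the two laws. *)
Lemma integral_indep_mul (f g : T -> R) :
  measurable_fun setT f -> measurable_fun setT g -> indep_pair f g ->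
  (forall t, 0 <= f t) -> (forall t, 0 <= g t) ->
  (\int[P]_t (f t * g t)%:E = \int[P]_t (f t)%:E * \int[P]_t (g t)%:E)%E.
Proof.
move=> mf mg ind f0 g0.
pose F : {mfun T >-> R} := HB.pack f (isMeasurableFun.Build _ _ _ _ _ mf).
pose G : {mfun T >-> R} := HB.pack g (isMeasurableFun.Build _ _ _ _ _ mg).
have mFG : measurable_fun setT (fun t => (f t, g t)).
  by apply: measurable_fun_pair.
pose FG : {mfun T >-> (R * R)%type} := HB.pack (fun t => (f t, g t))
  (isMeasurableFun.Build _ _ _ _ _ mFG).
(* Tonelli's theorem asks for nonnegativity on the whole plane, not only on the
   range of (f, g); absolute values provide it. *)
pose a (y : R) : R := `|y|.
have a0 (y : R) : 0 <= a y by exact: normr_ge0.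
have aE (y : R) : 0 <= y -> a y = y by move=> y0; rewrite /a ger0_norm.
have ma : measurable_fun [set: R] a by exact: measurableT_comp.
have mp : measurable_fun [set: (R * R)%type] (EFin \o (fun z : R * R => a z.1 * a z.2)).
  by apply/measurable_EFinP; apply: measurable_funM; exact: measurableT_comp.
transitivity (\int[distribution P FG]_z (a z.1 * a z.2)%:E)%E.
  rewrite ge0_integral_pushforward//=.
    by apply: eq_integral => t _ /=; rewrite !aE.
  by move=> z _; rewrite lee_fin mulr_ge0.
transitivity (\int[distribution P F \x distribution P G]_z (a z.1 * a z.2)%:E)%E.
  apply: eq_measure_integral => E mE _; apply/esym.
  exact: (@indep_pair_law F G ind E mE).
rewrite fubini_tonelli1//=; last by move=> z; rewrite lee_fin mulr_ge0.
have intE (X : {mfun T >-> R}) : (forall t, 0 <= X t) ->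
    (\int[P]_t (X t)%:E = \int[distribution P X]_y (a y)%:E)%E.
  move=> X0; rewrite ge0_integral_pushforward//=.
  - by apply: eq_integral => t _ /=; rewrite aE.
  - exact/measurable_EFinP.
  - by move=> z _; rewrite lee_fin.
have mEa : measurable_fun [set: R] (EFin \o a) by exact/measurable_EFinP.
rewrite (intE F f0) (intE G g0) /fubini_F/=.
have ea0 y : (0 <= (a y)%:E)%E by rewrite lee_fin.
transitivity (\int[distribution P F]_x ((a x)%:E * \int[distribution P G]_y (a y)%:E))%E.
  apply: eq_integral => x _; under eq_integral do rewrite EFinM.
  by apply: ge0_integralZl => //; exact: mEa.
by apply: ge0_integralZr => //; exact: integral_ge0.
Qed.

End Independence.

(** * Exponential laws *)

Section Density.
Context (R : realType).
Local Notation mu := (@lebesgue_measure R).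

(** The density agrees almost everywhere with the Radon-Nikodym derivative. *)
Lemma integral_density (nu : {finite_measure set (measurableTypeR R) -> \bar R}) (g : R -> R) :
  measurable_fun setT g -> (forall x, 0 <= g x) ->
  (forall A, measurable A -> nu A = \int[mu]_(x in A) (g x)%:E)%E ->
  forall f : R -> \bar R, measurable_fun setT f -> (forall x, 0 <= f x)%E ->
  (\int[nu]_x f x = \int[mu]_x (f x * (g x)%:E))%E.
Proof.
move=> mg g0 nug f mf f0.
have mEg : measurable_fun setT (EFin \o g) by exact/measurable_EFinP.
have dom : nu `<< mu.
  apply/null_content_dominatesP => A mA A0; rewrite nug//.
  by apply: null_set_integral => //; exact: measurable_funTS.
have ig : mu.-integrable setT (EFin \o g).
  apply/integrableP; split => //.
  under eq_integral do rewrite /= ger0_norm//.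
  by rewrite -nug// ltey_eq fin_num_measure.
rewrite -(Radon_Nikodym_SigmaFinite.change_of_variables dom)//.
apply: ae_eq_integral => //.
- apply: emeasurable_funM => //.
  exact: measurable_int (Radon_Nikodym_SigmaFinite.f_integrable dom).
- exact: emeasurable_funM.
- apply: ae_eqe_mul2l => /=.
  apply: integral_ae_eq => //.
  + exact: Radon_Nikodym_SigmaFinite.f_integrable.
  + move=> E _ mE; rewrite -Radon_Nikodym_SigmaFinite.f_integral// nug//.
Qed.

End Density.

(** The law of a bare function, since the families below are modified pointwise
and are not bundled with proofs of measurability. *)
Definition exp_law_of d (T : measurableType d) (R : realType) (P : probability T R)
  (r : R) (X : T -> R) :=
  forall B : set R, measurable B -> P (X @^-1` B) = exponential_prob r B.

Lemma measurable_preimage d (T : measurableType d) (R : realType) (X : T -> R)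
  (B : set R) : measurable_fun setT X ->
  measurable B -> measurable (X @^-1` B).
Proof. by move=> mX mB; rewrite -[X in measurable X]setTI; exact: mX. Qed.

Section RayUnique.
Context (R : realType).
Lemma ray_unique (m1 m2 : {measure set (measurableTypeR R) -> \bar R}) :
  (forall t : R, m1 `]t, +oo[%classic = m2 `]t, +oo[%classic) ->
  (forall t : R, m1 `]t, +oo[%classic < +oo)%E ->
  forall A, measurable A -> m1 A = m2 A.
Proof.
move=> m12 m1oo A mA.
apply: (@measure_unique _ R (measurableTypeR R) (@RGenOInfty.G R)
  (fun n : nat => `]- n%:R, +oo[%classic : set R)) => //.
- exact: RGenOInfty.measurableE.
- move=> _ _ [x ->] [y ->]; exists (Num.max x y).
  apply/seteqP; split => z /=; rewrite !in_itv/= !andbT gt_max.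
    by move=> [-> ->].
  by move/andP.
- by move=> n; exists (- n%:R).
- rewrite -subTset => x _; exists (Num.truncn `|x|).+1 => //=.
  rewrite in_itv/= andbT ltrNl (le_lt_trans _ (Num.Theory.truncnS_gt _))//.
  by rewrite -normrN ler_norm.
- by move=> B [x ->].
Qed.

End RayUnique.

Section ExponentialTail.
Context d (T : measurableType d) (R : realType) (P : probability T R).
Implicit Types (X Y : T -> R) (r s t : R).
Local Notation exp_law := (exp_law_of P).

Lemma exp_law_tail r X t : 0 < r -> measurable_fun setT X -> exp_law r X -> 0 <= t ->
  P (X @^-1` `]t, +oo[) = (expR (- r * t))%:E.
Proof.
move=> r0 mX rX t0.
have -> : X @^-1` `]t, +oo[ = ~` (X @^-1` `]-oo, t]).
  by rewrite -setCitvl preimage_setC.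
rewrite probability_setC; last by exact: measurable_preimage.
rewrite rX//.
have -> : exponential_prob r `]-oo, t] = exponential_prob r `[0, t].
  rewrite /exponential_prob integral_mkcond [RHS]integral_mkcond.
  apply: eq_integral => x _; rewrite !patchE !mem_setE !in_itv/=.
  have [x0|x0] := leP 0 x; first by [].
  by rewrite (lt0_exponential_pdf _ x0) if_same.
move: t0; rewrite le_eqVlt => /predU1P[<-|t0].
  rewrite mulr0 expR0 set_itv1 /exponential_prob null_set_integral ?sube0//.
    apply/measurable_EFinP; apply: measurable_funTS.
    exact: measurable_exponential_pdf.
  exact: lebesgue_measure_set1.
rewrite exponential_prob_itv0c//.
by apply: (congr1 EFin (_ : 1 - (1 - expR (- r * t)) = _)); rewrite opprB addrC subrK.
Qed.

Lemma exp_law_tail_neg r X t : 0 < r -> measurable_fun setT X -> exp_law r X -> t <= 0 ->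
  P (X @^-1` `]t, +oo[) = 1%E.
Proof.
move=> r0 mX rX t0; apply/eqP; rewrite eq_le probability_le1//=; last first.
  by exact: measurable_preimage.
rewrite -[leLHS]/(1%R%:E) -(expR0 R) -[0](mulr0 (- r)) -(exp_law_tail r0 mX rX (lexx 0)).
apply: le_measure; rewrite ?inE; try by exact: measurable_preimage.
by move=> x /=; rewrite !in_itv/= !andbT; exact: le_lt_trans.
Qed.

Lemma exp_law_ge0 r X : 0 < r -> measurable_fun setT X -> exp_law r X ->
  P (X @^-1` `]-oo, 0[) = 0%E.
Proof.
move=> r0 mX rX; rewrite rX// /exponential_prob integral0_eq// => x /=.
by rewrite in_itv/= => x0; rewrite lt0_exponential_pdf.
Qed.

End ExponentialTail.

Section ExponentialLaw.
Context d (T : measurableType d) (R : realType) (P : probability T R).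
Implicit Types (X Y : T -> R) (r s t : R).
Local Notation exp_law := (exp_law_of P).

(** Tails at nonnegative times determine the law, because they leave no mass to
the negative reals. *)
Lemma tail_exp_law r X : 0 < r -> measurable_fun setT X ->
  (forall t, 0 <= t -> P (X @^-1` `]t, +oo[) = (expR (- r * t))%:E) ->
  exp_law r X.
Proof.
move=> r0 mX tX B mB.
pose F : {mfun T >-> measurableTypeR R} := HB.pack (X : T -> measurableTypeR R)
  (isMeasurableFun.Build _ _ T (measurableTypeR R) X mX).
pose Q : probability (measurableTypeR R) R :=
  exponential_distribution_exponential_prob__canonical__probability_measure_Probability r0.
pose iR : measurableTypeR R -> R := idfun.
have Qid : exp_law_of Q r iR by [].
apply: (@ray_unique R (distribution P F) Q) => //; last first.
  by move=> t; rewrite (le_lt_trans (probability_le1 _ _))// ltry.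
move=> t; rewrite /distribution/= /pushforward.
have mid : measurable_fun setT iR by exact: measurable_id.
have [t0|/ltW t0] := leP 0 t.
  by rewrite [LHS]tX// [RHS](exp_law_tail r0 mid Qid).
rewrite [RHS](exp_law_tail_neg r0 mid Qid)//.
have mXt u : measurable (X @^-1` `]u, +oo[) by exact: measurable_preimage.
apply/eqP; rewrite eq_le probability_le1//=.
apply: (@le_trans _ _ (P (X @^-1` `]0, +oo[))).
  by rewrite tX// mulr0 expR0.
apply: le_measure; rewrite ?inE//.
by move=> x /=; rewrite !in_itv/= !andbT; exact: le_lt_trans.
Qed.

Lemma exp_law_scale s X : 0 < s -> measurable_fun setT X -> exp_law_of P 1 X ->
  exp_law_of P s (fun x => X x / s).
Proof.
move=> s0 mX rX; apply: tail_exp_law => //.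
  by apply: measurable_funM.
move=> t t0; rewrite -[RHS](_ : (expR (- 1 * (s * t)))%:E = _); last first.
  by rewrite mulN1r mulNr.
rewrite -(exp_law_tail _ mX rX)//; last by rewrite mulr_ge0// ltW.
rewrite (_ : _ @^-1` _ = X @^-1` `]s * t, +oo[)//.
by apply/seteqP; split => x /=; rewrite !in_itv/= !andbT ltr_pdivlMr// mulrC.
Qed.

(** Tilting the density of rate r by exp(s x) gives a multiple of the density of
rate r - s. *)
Lemma exp_law_mgf r s X : 0 < r -> s < r -> measurable_fun setT X -> exp_law r X ->
  (\int[P]_t (expR (s * X t))%:E = (r / (r - s))%:E)%E.
Proof.
move=> r0 sr mX rX.
pose F : {mfun T >-> measurableTypeR R} := HB.pack (X : T -> measurableTypeR R)
  (isMeasurableFun.Build _ _ T (measurableTypeR R) X mX).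
have me : measurable_fun [set: R] (EFin \o (fun y => expR (s * y))).
  apply/measurable_EFinP; apply: measurableT_comp => //.
transitivity (\int[distribution P F]_y (expR (s * y))%:E)%E.
  by rewrite ge0_integral_pushforward//= => y _; rewrite lee_fin expR_ge0.
rewrite (@integral_density _ _ (exponential_pdf r))//; last 2 first.
- exact: measurable_exponential_pdf.
- by move=> x; apply: exponential_pdf_ge0; exact: ltW.
have rs0 : 0 < r - s by rewrite subr_gt0.
transitivity (\int[lebesgue_measure]_x ((r / (r - s))%:E * (exponential_pdf (r - s) x)%:E))%E.
  apply: eq_integral => x _; rewrite -!EFinM; congr EFin.
  have [x0|x0] := leP 0 x; last by rewrite !lt0_exponential_pdf// !mulr0.
  rewrite !exponential_pdfE// mulrCA -expRD [RHS]mulrA divfK ?gt_eqF//.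
  by congr (_ * expR _); ring.
rewrite ge0_integralZl//.
- by rewrite integral_exponential_pdf// mule1.
- by apply/measurable_EFinP; exact: measurable_exponential_pdf.
- by move=> x _; rewrite lee_fin; apply: exponential_pdf_ge0; exact: ltW.
- by rewrite lee_fin divr_ge0// ltW.
Qed.

End ExponentialLaw.

(** * Memorylessness and the Burke flip at one site *)

Section Burke.
Context d (T : measurableType d) (R : realType) (P : probability T R).
Implicit Types (X Y W : T -> R) (a b t : R).
Local Notation exp_law := (exp_law_of P).

Lemma memoryless a X t : 0 < a -> measurable_fun setT X -> exp_law a X -> 0 <= t ->
  forall A : set R, measurable A ->
  (P (X @^-1` `]t, +oo[ `&` (fun u => X u - t)%R @^-1` A) =
   (expR (- a * t))%:E * P (X @^-1` A))%E.
Proof.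
move=> a0 mX aX t0 A mA.
have mD : measurable (X @^-1` `]t, +oo[) by exact: measurable_preimage.
have mXt : measurable_fun setT (fun u => X u - t) by exact: measurable_funB.
have mPre B : measurable B -> measurable (X @^-1` B).
  by move=> mB; exact: measurable_preimage.
pose F : {mfun T >-> measurableTypeR R} := HB.pack (X : T -> measurableTypeR R)
  (isMeasurableFun.Build _ _ T (measurableTypeR R) X mX).
pose G : {mfun T >-> measurableTypeR R} := HB.pack ((fun u => X u - t) : T -> measurableTypeR R)
  (isMeasurableFun.Build _ _ T (measurableTypeR R) (fun u => X u - t) mXt).
have e0 : 0 <= expR (- a * t) by exact: expR_ge0.
rewrite setIC.
apply: (@ray_unique R (pushforward (mrestr P mD) G)
  (mscale (NngNum e0) (distribution P F))) => //.
- move=> s; rewrite /pushforward/= /mrestr /mscale/= /distribution/pushforward/=.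
  rewrite [in LHS](_ : _ `&` _ = X @^-1` `]t + Num.max s 0, +oo[); last first.
    apply/seteqP; split => u /=; rewrite !in_itv/= !andbT ltrBrDl.
      by move=> [? ?]; rewrite addr_maxr gt_max addr0; apply/andP.
    by rewrite addr_maxr gt_max addr0 => /andP.
  rewrite [LHS](exp_law_tail a0 mX aX); last by rewrite addr_ge0// le_max lexx orbT.
  have [s0|s0] := leP 0 s.
    rewrite [in RHS](exp_law_tail a0 mX aX)// -EFinM -expRD; congr (expR _)%:E.
    by ring.
  by rewrite [X in _ = (_ * X)%E](exp_law_tail_neg a0 mX aX) ?ltW// mule1 addr0.
- move=> s; rewrite /pushforward/= /mrestr.
  by rewrite (le_lt_trans (probability_le1 _ _))// ?ltry//; apply: measurableI => //; exact: measurable_preimage.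
Qed.

(** On rectangles this is memorylessness of each variable. *)
Lemma pair_memoryless a b X Y t : 0 < a -> 0 < b ->
  measurable_fun setT X -> measurable_fun setT Y ->
  exp_law a X -> exp_law b Y -> indep_pair P X Y -> 0 <= t ->
  forall E : set (R * R), measurable E ->
  (P ((X @^-1` `]t, +oo[ `&` Y @^-1` `]t, +oo[) `&`
       [set u | E (X u - t, Y u - t)%R]) =
   (expR (- (a + b) * t))%:E * P [set u | E (X u, Y u)])%E.
Proof.
move=> a0 b0 mX mY aX bY XY t0 E mE.
have mDX : measurable (X @^-1` `]t, +oo[) by exact: measurable_preimage.
have mDY : measurable (Y @^-1` `]t, +oo[) by exact: measurable_preimage.
have mD := measurableI _ _ mDX mDY.
have mXt : measurable_fun setT (fun u => X u - t) by exact: measurable_funB.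
have mYt : measurable_fun setT (fun u => Y u - t) by exact: measurable_funB.
have mXY : measurable_fun setT (fun u => (X u, Y u)) by exact: measurable_fun_pair.
have mXYt : measurable_fun setT (fun u => (X u - t, Y u - t)).
  exact: measurable_fun_pair.
pose FX : {mfun T >-> R} := HB.pack X (isMeasurableFun.Build _ _ _ _ _ mX).
pose FY : {mfun T >-> R} := HB.pack Y (isMeasurableFun.Build _ _ _ _ _ mY).
pose F : {mfun T >-> (R * R)%type} := HB.pack (fun u => (X u, Y u))
  (isMeasurableFun.Build _ _ _ _ _ mXY).
pose G : {mfun T >-> (R * R)%type} := HB.pack (fun u => (X u - t, Y u - t))
  (isMeasurableFun.Build _ _ _ _ _ mXYt).
have e0 c : 0 <= expR (- c * t) by exact: expR_ge0.
pose m1 := mscale (NngNum (e0 a)) (distribution P FX).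
pose m2 := mscale (NngNum (e0 b)) (distribution P FY).
transitivity ((m1 \x m2) E)%E; last first.
  apply: (product_measure_unique (m' := mscale (NngNum (e0 (a + b))) (distribution P F))) => //.
  move=> A B mA mB; rewrite /m1 /m2 /mscale/= /distribution/pushforward/=.
  transitivity ((expR (- (a + b) * t))%:E * (P (X @^-1` A) * P (Y @^-1` B)))%E.
    by rewrite -XY.
  by rewrite muleACA -EFinM -expRD -mulrDl -opprD.
rewrite setIC; apply/esym.
apply: (product_measure_unique (m' := pushforward (mrestr P mD) G)) => //.
move=> A B mA mB; rewrite /m1 /m2 /mscale/= /distribution/pushforward/= /mrestr.
transitivity (((expR (- a * t))%:E * P (X @^-1` A)) *
   ((expR (- b * t))%:E * P (Y @^-1` B)))%E; last by [].
rewrite -(memoryless a0 mX aX t0 mA) -(memoryless b0 mY bY t0 mB).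
rewrite [X in P X = _](_ : _ = X @^-1` (`]t, +oo[ `&` (fun x => x - t) @^-1` A) `&`
  Y @^-1` (`]t, +oo[ `&` (fun x => x - t) @^-1` B)); last first.
  by apply/seteqP; split => u /= [[? ?] [? ?]].
have ms : measurable_fun [set: R] (fun x => x - t) by exact: measurable_funB.
by rewrite [LHS]XY//; apply: measurableI => //; exact: measurable_preimage.
Qed.

Lemma exp_min a b X Y : 0 < a -> 0 < b ->
  measurable_fun setT X -> measurable_fun setT Y ->
  exp_law a X -> exp_law b Y -> indep_pair P X Y ->
  exp_law (a + b) (fun u => Num.min (X u) (Y u)).
Proof.
move=> a0 b0 mX mY aX bY XY; apply: tail_exp_law; first by rewrite addr_gt0.
  exact: measurable_minr.
move=> t t0.
rewrite (_ : _ @^-1` _ = X @^-1` `]t, +oo[ `&` Y @^-1` `]t, +oo[); last first.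
  by apply/seteqP; split => u /=; rewrite !in_itv/= !andbT lt_min => /andP.
rewrite XY// (exp_law_tail a0 mX aX)// (exp_law_tail b0 mY bY)//.
by rewrite -EFinM -expRD -mulrDl -opprD.
Qed.

Lemma preimage_generated (S : pointedType) d' (T' : measurableType d') (H : set (set T'))
    (G : set (set S)) (f : S -> T') :
  measurable = <<s H >> -> (forall A, H A -> G (f @^-1` A)) ->
  forall E, measurable E -> <<s G >> (f @^-1` E).
Proof.
move=> mH HG E; rewrite mH.
move=> HE; have : preimage_set_system setT f (H.-sigma.-measurable) (f @^-1` E).
  by exists E => //; rewrite setTI.
rewrite -g_sigma_preimageE.
apply: (smallest_sub (smallest_sigma_algebra _ _)) => _ [A HA <-].
by rewrite setTI; apply: sub_sigma_algebra; exact: HG.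
Qed.

Lemma measurable_rect :
  @measurable _ (R * R)%type = <<s [set A `*` B | A in measurable & B in measurable] >>.
Proof. exact: measurable_prod_measurableType. Qed.

Lemma prob_setI_full (A B : set T) : measurable A -> measurable B ->
  P A = 1%E -> P (A `&` B) = P B.
Proof.
move=> mA mB A1; rewrite [RHS](measureDI P mB mA) [X in (X + _)%E](_ : _ = 0)%E.
  by rewrite add0e setIC.
apply/eqP; rewrite eq_le measure_ge0 andbT.
apply: (@le_trans _ _ (P (~` A))).
  apply: le_measure; rewrite ?inE; [exact: measurableD|exact: measurableC|].
  by move=> x [].
by rewrite probability_setC// A1 subee.
Qed.

(** The event min(X, Y) > t shifts both variables by t, which leaves their
difference unchanged; by memorylessness it is therefore independent of the
difference. *)
Lemma min_diff_indep a b X Y : 0 < a -> 0 < b ->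
  measurable_fun setT X -> measurable_fun setT Y ->
  exp_law a X -> exp_law b Y -> indep_pair P X Y ->
  indep_pair P (fun u => Num.min (X u) (Y u)) (fun u => X u - Y u).
Proof.
move=> a0 b0 mX mY aX bY XY M D mM mD.
have mm : measurable_fun setT (fun u => Num.min (X u) (Y u)).
  exact: measurable_minr.
have md : measurable_fun setT (fun u => X u - Y u) by exact: measurable_funB.
have em := exp_min a0 b0 mX mY aX bY XY.
set m := fun u => Num.min (X u) (Y u) in mm em *.
set d' := fun u => X u - Y u in md *.
have ab0 : 0 < a + b by rewrite addr_gt0.
apply: (@indep_dynkin _ _ _ P [set m @^-1` `]t, +oo[ | t in [set: R]]); last first.
- apply: (@preimage_generated _ _ _ (@RGenOInfty.G R)) => //.
    exact: RGenOInfty.measurableE.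
  by move=> _ [t ->]; exists t.
- move=> _ [t _ <-].
  have mt : measurable (m @^-1` `]t, +oo[) by exact: measurable_preimage.
  have mdD : measurable (d' @^-1` D) by exact: measurable_preimage.
  have [t0|/ltW t0] := leP 0 t; last first.
    have m1 := exp_law_tail_neg ab0 mm em t0.
    by rewrite prob_setI_full// m1 mul1e.
  rewrite (exp_law_tail ab0 mm em)//.
  pose E := (fun z : R * R => z.1 - z.2) @^-1` D.
  have mE : measurable E.
    rewrite -[E]setTI; apply: measurable_funB => //.
  rewrite -[X in _ = (_ * P X)%E]/([set u | E (X u, Y u)]).
  rewrite -(pair_memoryless a0 b0 mX mY aX bY XY t0 mE).
  congr (P _); apply/seteqP; split => u /=; rewrite !in_itv/= !andbT /m lt_min.
    by move=> [/andP[-> ->] dD]; split => //; rewrite /E/= opprB addrA subrK.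
  by move=> [[-> ->]]; rewrite /E/= opprB addrA subrK.
- exact: measurable_preimage.
- move=> _ _ [s _ <-] [t _ <-]; exists (Num.max s t) => //.
  by apply/seteqP; split => u /=; rewrite !in_itv/= !andbT gt_max; [move/andP|move=> [-> ->]].
- by move=> _ [t _ <-]; exact: measurable_preimage.
Qed.

End Burke.

Section Flip.
Context d (T : measurableType d) (R : realType) (P : probability T R).
Context (I : choiceType).
Implicit Types (X : I -> T -> R) (r : I -> R).
Local Notation exp_law := (exp_law_of P).

Definition indep_exp r X := indep_family P X /\ forall i, exp_law (r i) (X i).

(** The coordinates i and j hold the increments entering a site, and k its
weight. Storing the minimum in the coordinate k keeps the index set and the
rates unchanged, so that flips can be iterated. *)
Definition flip (i j k : I) X (l : I) : T -> R :=
  if l == i then fun u => X k u + Num.max (X i u - X j u) 0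
  else if l == j then fun u => X k u + Num.max (X j u - X i u) 0
  else if l == k then fun u => Num.min (X i u) (X j u)
  else X l.

(** Isolates the three coordinates changed by a flip in a cylinder event. *)
Lemma bigcap_three (i j k : I) (Z : I -> T -> R) (s : seq I) (B : I -> set R) :
  \bigcap_(l in [set` s]) (Z l @^-1` B l) =
  (Z i @^-1` (if i \in s then B i else setT) `&`
   (Z j @^-1` (if j \in s then B j else setT) `&`
    Z k @^-1` (if k \in s then B k else setT))) `&`
  \bigcap_(l in [set` [seq l <- s | l \notin [:: i; j; k]]]) (Z l @^-1` B l).
Proof.
apply/seteqP; split => u /=.
  move=> H; split.
    by split; [|split]; case: ifP => // /H.
  by move=> l /=; rewrite mem_filter => /andP[_ /H].
move=> [[Hi [Hj Hk]] H] l /= ls.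
have [lijk|lijk] := boolP (l \in [:: i; j; k]); last first.
  by apply: H; rewrite /= mem_filter lijk.
move: lijk Hi Hj Hk ls; rewrite !inE => /or3P[]/eqP-> Hi Hj Hk ls.
- by rewrite ls in Hi.
- by rewrite ls in Hj.
- by rewrite ls in Hk.
Qed.

(** With m := min(X i, X j) and df := X i - X j, the variables m, df and X k are
independent, and m has the law of X k. Exchanging m and X k turns X i and X j,
which are m plus the positive and negative parts of df, into the flipped
coordinates. *)
Lemma flip_joint r X i j k B1 B2 B3 A :
  indep_exp r X -> (forall l, 0 < r l) -> r k = r i + r j ->
  i != j -> i != k -> j != k ->
  measurable B1 -> measurable B2 -> measurable B3 ->
  <<s cylinders X [set l | l \notin [:: i; j; k]] >> A ->
  (P ((flip i j k X i @^-1` B1 `&` (flip i j k X j @^-1` B2 `&`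
        flip i j k X k @^-1` B3)) `&` A) =
   P (X i @^-1` B1) * P (X j @^-1` B2) * P (X k @^-1` B3) * P A)%E.
Proof.
move=> [iX lX] r0 rk ij ik jk mB1 mB2 mB3 sA.
have [mX _] := iX.
have -> : flip i j k X i = fun u => X k u + Num.max (X i u - X j u) 0.
  by rewrite /flip eqxx.
have -> : flip i j k X j = fun u => X k u + Num.max (X j u - X i u) 0.
  by rewrite /flip eq_sym (negbTE ij) eqxx.
have -> : flip i j k X k = fun u => Num.min (X i u) (X j u).
  by rewrite /flip eq_sym (negbTE ik) eq_sym (negbTE jk) eqxx.
set m := fun u => Num.min (X i u) (X j u).
pose df := fun u => X i u - X j u.
pose J := [set l | l \in [:: i; j; k]].
have Ji : J i by rewrite /J/= !inE eqxx.
have Jj : J j by rewrite /J/= !inE eqxx orbT.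
have Jk : J k by rewrite /J/= !inE eqxx !orbT.
have ki : known_by X J (X i) by exact: known_coord.
have kj : known_by X J (X j) by exact: known_coord.
have kk : known_by X J (X k) by exact: known_coord.
have kpre f B : known_by X J f -> measurable B -> <<s cylinders X J >> (f @^-1` B).
  by move=> kf mB; have := kf measurableT B mB; rewrite setTI.
have kd (f g : T -> R) : known_by X J f -> known_by X J g ->
    known_by X J (fun u => X k u + Num.max (f u - g u) 0).
  move=> kf kg; apply: measurable_funD => //; apply: measurable_maxr => //.
  exact: measurable_funB.
rewrite (@indep_grouping _ _ _ P _ X J [set l | l \notin [:: i; j; k]])//; last 2 first.
- by apply/seteqP; split => // l [/= -> ].
- apply: (@measurableI _ (g_sigma_algebraType (cylinders X J))).
    by apply: kpre => //; exact: kd.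
  apply: (@measurableI _ (g_sigma_algebraType (cylinders X J))).
    by apply: kpre => //; exact: kd.
  by apply: kpre => //; exact: measurable_minr.
congr (_ * _)%E.
have iij : indep_pair P (X i) (X j).
  apply: (@indep_pair_known _ _ _ P _ X [set i] [set j]) => //; try exact: known_coord.
  by apply/seteqP; split => // l [/= -> /eqP]; rewrite (negbTE ij).
have mm : measurable_fun setT m by exact: measurable_minr.
have md : measurable_fun setT df by exact: measurable_funB.
have em : exp_law (r k) m.
  by rewrite rk; apply: exp_min.
have imd : indep_pair P m df by apply: (min_diff_indep (r0 i) (r0 j)).
have iWD (D : set R) (M : set R) V : measurable D -> measurable M -> measurable V ->
   (P (X k @^-1` V `&` (df @^-1` D `&` m @^-1` M)) =
    P (X k @^-1` V) * P (df @^-1` D `&` m @^-1` M))%E.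
  move=> mD mM mV.
  apply: (@indep_grouping _ _ _ P _ X [set k] [set i; j]) => //.
  - apply/seteqP; split => // l [/= -> []/eqP]; first by rewrite eq_sym (negbTE ik).
    by rewrite eq_sym (negbTE jk).
  - have kc : known_by X [set k] (X k) by exact: known_coord.
    by have := kc measurableT V mV; rewrite setTI.
  - have ki' : known_by X [set i; j] (X i) by apply: known_coord; left.
    have kj' : known_by X [set i; j] (X j) by apply: known_coord; right.
    have kdf : known_by X [set i; j] df by exact: measurable_funB.
    have km : known_by X [set i; j] m by exact: measurable_minr.
    apply: (@measurableI _ (g_sigma_algebraType (cylinders X [set i; j]))).
      by have := kdf measurableT D mD; rewrite setTI.
    by have := km measurableT M mM; rewrite setTI.
have iW : indep_pair P df (X k).
  move=> D V mD mV; rewrite setIC muleC.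
  by have := iWD D setT V mD measurableT mV; rewrite preimage_setT setIT.
(* The event that both flipped increments lie in their targets, read off from
   the pair (df, X k); evaluated at (df, m) it concerns X i and X j. *)
pose E := [set z : R * R | B1 (z.2 + Num.max z.1 0) /\ B2 (z.2 + Num.max (- z.1) 0)].
have mE : measurable E.
  have m1 : measurable_fun [set: (R * R)%type] (fun z : R * R => z.2 + Num.max z.1 0).
    by apply: measurable_funD => //; apply: measurable_maxr.
  have m2 : measurable_fun [set: (R * R)%type] (fun z : R * R => z.2 + Num.max (- z.1) 0).
    apply: measurable_funD => //; apply: measurable_maxr => //.
    exact: measurableT_comp.
  apply: measurableI.
    by have := m1 measurableT B1 mB1; rewrite setTI.
  by have := m2 measurableT B2 mB2; rewrite setTI.
have -> : P ((fun u => X k u + Num.max (X i u - X j u) 0) @^-1` B1 `&`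
    ((fun u => X k u + Num.max (X j u - X i u) 0) @^-1` B2 `&` m @^-1` B3)) =
    P ((fun u => (df u, X k u)) @^-1` E `&` m @^-1` B3).
  rewrite setIA; congr (P (_ `&` _)).
  by apply/seteqP; split => u; rewrite /E/= /df opprB.
have mp B : measurable B -> measurable (m @^-1` B).
  by move=> mB; exact: measurable_preimage.
have ind3 : (P ((fun u => (df u, X k u)) @^-1` E `&` m @^-1` B3) =
   P ((fun u => (df u, X k u)) @^-1` E) * P (m @^-1` B3))%E.
  apply: (@indep_dynkin _ _ _ P
    [set A | exists D V, [/\ measurable D, measurable V & A = df @^-1` D `&` X k @^-1` V]]); last first.
  - apply: (@preimage_generated _ _ _ _ _ _ (measurable_rect R)) => //.
    move=> _ [D mD [V mV <-]]; exists D, V; split => //.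
  - move=> _ [D [V [mD mV ->]]].
    rewrite (setIC (df @^-1` D)) -setIA iWD// setIC (imd _ _ mB3 mD) (setIC (X k @^-1` V)).
    by rewrite iW// muleCA muleA [in RHS]muleAC [LHS]muleC muleA.
  - exact: mp.
  - move=> _ _ [D [V [mD mV ->]]] [D' [V' [mD' mV' ->]]].
    exists (D `&` D'), (V `&` V'); split; try exact: measurableI.
    by rewrite !preimage_setI setIACA.
  - by move=> _ [D [V [mD mV ->]]]; apply: measurableI; exact: measurable_preimage.
rewrite ind3; congr (_ * _)%E; last by rewrite em// -lX.
rewrite [LHS](_ : _ = P [set u | E (df u, X k u)])//.
rewrite (@indep_pair_same_law _ _ _ P df (X k) m)//; last 2 first.
- by move=> D M mD mM; rewrite setIC muleC; exact: imd.
- by move=> B mB; rewrite em// -lX.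
rewrite -iij//; congr (P _).
have e1 (x y : R) : Num.min x y + Num.max (x - y) 0 = x.
  have [xy|xy] := leP x y.
    by rewrite max_r ?subr_le0// addr0.
  by rewrite max_l ?subr_ge0 1?ltW// addrC subrK.
have e2 (x y : R) : Num.min x y + Num.max (- (x - y)) 0 = y.
  by rewrite minC opprB e1.
by apply/seteqP; split => u; rewrite /E/= /df /m e1 e2.
Qed.

Lemma indep_exp_flip r X i j k :
  indep_exp r X -> (forall l, 0 < r l) -> r k = r i + r j ->
  i != j -> i != k -> j != k -> indep_exp r (flip i j k X).
Proof.
move=> iX r0 rk ij ik jk.
have [[mX indX] lX] := iX.
have FE l : l \notin [:: i; j; k] -> flip i j k X l = X l.
  by rewrite !inE !negb_or /flip => /and3P[/negbTE-> /negbTE-> /negbTE->].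
have mF l : measurable_fun setT (flip i j k X l).
  rewrite /flip; case: ifP => _.
    by apply: measurable_funD => //; apply: measurable_maxr => //; exact: measurable_funB.
  case: ifP => _.
    by apply: measurable_funD => //; apply: measurable_maxr => //; exact: measurable_funB.
  by case: ifP => _ //; exact: measurable_minr.
pose K := [set l | l \notin [:: i; j; k]].
have sT : <<s cylinders X K >> setT.
  by apply: (@measurableT _ (g_sigma_algebraType (cylinders X K))).
have marg l B : measurable B -> P (flip i j k X l @^-1` B) = P (X l @^-1` B).
  move=> mB.
  have [lK|lK] := boolP (l \in [:: i; j; k]); last by rewrite FE.
  have J B1 B2 B3 mB1 mB2 mB3 :=
    @flip_joint r X i j k B1 B2 B3 setT iX r0 rk ij ik jk mB1 mB2 mB3 sT.
  move: lK; rewrite !inE => /or3P[]/eqP->.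
  - have := J B setT setT mB measurableT measurableT.
    by rewrite !preimage_setT !setIT probability_setT !mule1.
  - have := J setT B setT measurableT mB measurableT.
    by rewrite !preimage_setT !setIT !setTI probability_setT !mule1 mul1e.
  - have := J setT setT B measurableT measurableT mB.
    by rewrite !preimage_setT !setIT !setTI probability_setT !mule1 !mul1e.
split; last by move=> l B mB; rewrite marg// lX.
split=> // s B us mB.
have ifm l : measurable (if l \in s then B l else setT) by case: ifP.
pose s' := [seq l <- s | l \notin [:: i; j; k]].
have sA : <<s cylinders X K >> (\bigcap_(l in [set` s']) (X l @^-1` B l)).
  apply: sub_sigma_algebra; exists s', B; split => //; first exact: filter_uniq.
  by move=> l /=; rewrite mem_filter => /andP[].
under eq_bigr do rewrite marg//.
rewrite -indX// (bigcap_three i j k) (bigcap_three i j k X) -/s'.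
have -> : \bigcap_(l in [set` s']) (flip i j k X l @^-1` B l) =
    \bigcap_(l in [set` s']) (X l @^-1` B l).
  by apply: eq_bigcapr => l /=; rewrite mem_filter => /andP[lK _]; rewrite FE.
rewrite [LHS](flip_joint iX r0 rk ij ik jk (ifm i) (ifm j) (ifm k) sA).
apply/esym.
have kX (J : set I) l C : J l -> measurable C -> <<s cylinders X J >> (X l @^-1` C).
  move=> Jl mC; have kl : known_by X J (X l) by exact: known_coord.
  by have := kl measurableT C mC; rewrite setTI.
have kI (J : set I) C D : <<s cylinders X J >> C -> <<s cylinders X J >> D ->
    <<s cylinders X J >> (C `&` D).
  exact: (@measurableI _ (g_sigma_algebraType (cylinders X J))).
rewrite (@indep_grouping _ _ _ P _ X [set l | l \in [:: i; j; k]] K)//; last 2 first.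
- by apply/seteqP; split => // l [/= lJ]; rewrite /K/= lJ.
- by apply: (kI); [|apply: (kI)]; apply: (kX) => //=; rewrite !inE eqxx ?orbT.
congr (_ * _)%E.
rewrite (@indep_grouping _ _ _ P _ X [set i] [set j; k])//; last 3 first.
- apply/seteqP; split => // l [/= -> []/eqP]; first by rewrite (negbTE ij).
  by rewrite (negbTE ik).
- exact: kX.
- by apply: (kI); apply: (kX) => //; [left|right].
rewrite (@indep_grouping _ _ _ P _ X [set j] [set k])//; last 3 first.
- by apply/seteqP; split => // l [/= -> /eqP]; rewrite (negbTE jk).
- exact: kX.
- exact: kX.
by rewrite muleA.
Qed.

End Flip.

(** * The last-passage recursion and its planarity *)

Section LastPassageRecursion.
Context (R : realType).
Implicit Types (w : nat -> nat -> R) (A B a b i j n : nat).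

(** [lpp w A B a b] is the passage time from (a, b) to (A, B) for the weights [w];
the fuel of [lpp_rec] is the number of remaining steps. *)
Fixpoint lpp_rec w A B n a b : R :=
  w a b + if n is n'.+1 then
    if a == A then lpp_rec w A B n' a b.+1
    else if b == B then lpp_rec w A B n' a.+1 b
    else Num.max (lpp_rec w A B n' a.+1 b) (lpp_rec w A B n' a b.+1)
  else 0.

Definition lpp w A B a b := lpp_rec w A B ((A - a) + (B - b)) a b.

Lemma lpp_end w A B : lpp w A B A B = w A B.
Proof. by rewrite /lpp !subnn /= addr0. Qed.

Lemma lpp_top w A B a : (a < A)%N -> lpp w A B a B = w a B + lpp w A B a.+1 B.
Proof.
move=> aA; rewrite /lpp subnn !addn0.
have -> : (A - a = (A - a.+1).+1)%N by lia.
by rewrite /= ltn_eqF// eqxx.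
Qed.

Lemma lpp_side w A B b : (b < B)%N -> lpp w A B A b = w A b + lpp w A B A b.+1.
Proof.
move=> bB; rewrite /lpp subnn !add0n.
have -> : (B - b = (B - b.+1).+1)%N by lia.
by rewrite /= eqxx.
Qed.

Lemma lpp_step w A B a b : (a < A)%N -> (b < B)%N ->
  lpp w A B a b = w a b + Num.max (lpp w A B a.+1 b) (lpp w A B a b.+1).
Proof.
move=> aA bB; rewrite /lpp.
have -> : (A - a.+1 + (B - b) = A - a + (B - b.+1))%N by lia.
have -> : (A - a + (B - b) = (A - a + (B - b.+1)).+1)%N by lia.
by rewrite /= ltn_eqF// ltn_eqF.
Qed.

(** Induction along the cases of the last-passage recursion. *)
Lemma quadrant_ind A B (Q : nat -> nat -> Prop) : Q A B ->
  (forall a, (a < A)%N -> Q a.+1 B -> Q a B) ->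
  (forall b, (b < B)%N -> Q A b.+1 -> Q A b) ->
  (forall a b, (a < A)%N -> (b < B)%N -> Q a.+1 b -> Q a b.+1 -> Q a b) ->
  forall a b, (a <= A)%N -> (b <= B)%N -> Q a b.
Proof.
move=> Qe Qt Qs Qi a b.
have [n] := ubnP ((A - a) + (B - b)); elim: n a b => // n IH a b nab aA bB.
have [aE|aA'] := eqVneq a A; have [bE|bB'] := eqVneq b B.
- by rewrite aE bE.
- by rewrite aE; apply: Qs; [lia|apply: IH; lia].
- by rewrite bE; apply: Qt; [lia|apply: IH; lia].
- by apply: Qi; [lia|lia|apply: IH; lia|apply: IH; lia].
Qed.

Lemma lpp_ext w w' A B a b : (a <= A)%N -> (b <= B)%N ->
  (forall i j, (a <= i <= A)%N -> (b <= j <= B)%N -> w i j = w' i j) ->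
  lpp w A B a b = lpp w' A B a b.
Proof.
move: a b; apply: quadrant_ind => [|a aA IH|b bB IH|a b aA bB IH1 IH2] ww'.
- by rewrite !lpp_end ww' ?leqnn.
- rewrite !(lpp_top _ _ aA); congr (_ + _); first by apply: ww'; lia.
  by apply: IH => i j ? ?; apply: ww'; lia.
- rewrite !(lpp_side _ _ bB); congr (_ + _); first by apply: ww'; lia.
  by apply: IH => i j ? ?; apply: ww'; lia.
- rewrite !(lpp_step _ aA bB); congr (_ + Num.max _ _); first by apply: ww'; lia.
    by apply: IH1 => i j ? ?; apply: ww'; lia.
  by apply: IH2 => i j ? ?; apply: ww'; lia.
Qed.

Section Nonneg.
Variables (w : nat -> nat -> R) (w0 : forall i j, 0 <= w i j).

Lemma lpp_ge0 A B a b : (a <= A)%N -> (b <= B)%N -> 0 <= lpp w A B a b.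
Proof.
move: a b; apply: quadrant_ind => [|a aA IH|b bB IH|a b aA bB IH1 IH2].
- by rewrite lpp_end.
- by rewrite lpp_top// addr_ge0.
- by rewrite lpp_side// addr_ge0.
- by rewrite lpp_step// addr_ge0// le_max IH1.
Qed.

Lemma lpp_le_up A B a b : (a <= A)%N -> (b < B)%N ->
  lpp w A B a b.+1 <= lpp w A B a b.
Proof.
rewrite leq_eqVlt => /predU1P[->|aA] bB.
  by rewrite (lpp_side _ _ bB) lerDr.
by rewrite (lpp_step _ aA bB) -[leLHS]add0r lerD// le_max lexx orbT.
Qed.

Lemma lpp_le_bottom A B a b : (a <= A)%N -> (b <= B)%N ->
  lpp w A B a b <= lpp w A B a 0.
Proof.
move=> aA; elim: b => // b IH bB.
by rewrite (le_trans (lpp_le_up aA bB))// IH// ltnW.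
Qed.

Variables (A B a b : nat).
Hypotheses (aA : (a < A)%N) (bB : (b < B)%N).
Let L := lpp w A B.
Let G := lpp w a b.

(* Replacing the weights of row b + 1 by the increments of L makes T the passage
   time to the corner over the paths that leave [0, a] x [0, b] through its top. *)
Let w' i j := if (j <= b)%N then w i j
  else if (i < a)%N then L i b.+1 - L i.+1 b.+1 else L a b.+1.
Let T := lpp w' a b.+1.

Let w'E i j : (j <= b)%N -> w' i j = w i j.
Proof. by rewrite /w' => ->. Qed.

Let T_top i : (i <= a)%N -> T i b.+1 = L i b.+1.
Proof.
move=> ia; have [n] := ubnP (a - i); elim: n i ia => // n IH i.
rewrite leq_eqVlt => /predU1P[->|ia] nai.
  by rewrite /T lpp_end /w' !ltnn.
rewrite /T lpp_top// -/T IH//; last by lia.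
by rewrite /w' ltnn ia subrK.
Qed.

Let T_le_L i j : (i <= a)%N -> (j <= b.+1)%N -> T i j <= L i j.
Proof.
move: i j; apply: quadrant_ind => [|i ia _|j jb IH|i j ia jb IH1 IH2].
- by rewrite T_top.
- by rewrite T_top// ltnW.
- rewrite /T lpp_side// -/T w'E// /L (lpp_step _ aA) -/L; last by lia.
  by rewrite lerD2l le_max IH orbT.
- rewrite /T lpp_step// -/T w'E// /L lpp_step -/L; [|lia|lia].
  by rewrite lerD2l ge_max !le_max IH1 IH2 orbT.
Qed.

(* An optimal path leaves through the top, or else it first reaches column a
   and then crosses to column a + 1. *)
Let L_le i j : (i <= a)%N -> (j <= b)%N ->
  L i j <= Num.max (T i j) (G i j + L a.+1 0).
Proof.
have K j' : (j' <= b)%N -> L a.+1 j' <= L a.+1 0.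
  by move=> jb; apply: lpp_le_bottom => //; lia.
move: i j; apply: quadrant_ind => [|i ia IH|j jb IH|i j ia jb IH1 IH2].
- rewrite /L lpp_step// -/L /T lpp_side// -/T w'E// T_top// /G lpp_end.
  have := K b (leqnn _); rewrite le_max.
  by case: (leP (L a.+1 b) (L a b.+1)) => _ H; rewrite ?lexx// !lerD2l H orbT.
- rewrite /L lpp_step -/L; [|lia|lia].
  rewrite /T lpp_step// -/T w'E// T_top ?(ltnW ia)// /G lpp_top// -/G.
  move: IH; rewrite -addrA -addr_maxr lerD2l ge_max !le_max lexx orbT /= andbT.
  by move=> /orP[->|->]; rewrite ?orbT.
- rewrite /L lpp_step -/L; [|lia|lia].
  rewrite /T lpp_side -/T ?w'E ?(ltnW jb)//; last by lia.
  rewrite /G lpp_side// -/G.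
  rewrite -addrA -addr_maxr lerD2l ge_max le_max; apply/andP; split.
    apply/orP; right; apply: (le_trans (K _ (ltnW jb))).
    by rewrite lerDr; apply: lpp_ge0.
  by move: IH; rewrite !le_max.
- rewrite /L lpp_step -/L; [|lia|lia].
  rewrite /T lpp_step -/T ?w'E ?(ltnW jb)//; last by lia.
  rewrite /G lpp_step// -/G.
  rewrite -addrA -addr_maxr lerD2l addr_maxl maxACA.
  rewrite ge_max !le_max; move: IH1 IH2; rewrite !le_max.
  by move=> /orP[->|->] /orP[->|->]; rewrite ?orbT.
Qed.

(* Horizontal increments satisfy I(z) = w(z) + (I(z + e_2) - J(z + e_1))^+, which
   increases with I and decreases with J, and vertical ones J(z) the same formula
   with I(z + e_2) and J(z + e_1) exchanged; so the comparison holds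
   throughout once it holds on the top row, where the horizontal increments of G
   are single weights, and on the last column, where the vertical increments of
   both G and T are. *)
Let compare i j : (i <= a)%N -> (j <= b)%N ->
  ((i < a)%N -> G i j - G i.+1 j <= T i j - T i.+1 j) /\
  ((j < b)%N -> T i j - T i j.+1 <= G i j - G i j.+1).
Proof.
move: i j; apply: quadrant_ind => [|i ia IH|j jb IH|i j ia jb IH1 IH2].
- by rewrite !ltnn.
- rewrite ltnn; split=> // _; rewrite /G lpp_top// -/G /T (lpp_step _ ia)// -/T.
  by rewrite w'E// addrK lerBrDr lerD2l le_max lexx.
- rewrite ltnn; split=> // _; rewrite /G lpp_side// -/G /T (@lpp_side _ _ _ j) -/T; last by lia.
  by rewrite w'E 1?ltnW// !addrK.
- have [_ {}IH1] := IH1; have [{}IH2 _] := IH2.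
  have {}IH1 := IH1 jb; have {}IH2 := IH2 ia.
  have TE : T i j = w i j + Num.max (T i.+1 j) (T i j.+1).
    by rewrite /T lpp_step ?w'E//; lia.
  have GE : G i j = w i j + Num.max (G i.+1 j) (G i j.+1).
    by rewrite /G lpp_step.
  rewrite TE GE.
  case: (leP (T i.+1 j) (T i j.+1)) => ?; case: (leP (G i.+1 j) (G i j.+1)) => ?.
  all: split => _; lra.
Qed.

(** Either the optimal path from (1, 0) leaves the rectangle [0, a] x [0, b]
through its right side, or L prefers (1, 0) to (0, 1) at most as much as the
passage times to (a, b) do. *)
Lemma exit_dichotomy : (0 < a)%N -> (0 < b)%N ->
  L 1 0 <= G 1 0 + L a.+1 0 \/ L 1 0 - L 0 1 <= G 1 0 - G 0 1.
Proof.
move=> a0 b0; have := L_le a0 (leq0n b).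
rewrite le_max => /orP[LT|]; [right|by left].
have [_ /(_ b0) h1] := compare a0 (leq0n b).
have [/(_ a0) h2 _] := compare (leq0n a) b0.
have h3 := T_le_L (leq0n a) (leqW b0).
lra.
Qed.

End Nonneg.
End LastPassageRecursion.

(** * Increments of the stationary model *)

Section StationaryBox.
Context d (T : measurableType d) (R : realType) (P : probability T R).
Variables (be : R) (A B : nat).
Hypothesis be01 : 0 < be < 1.

(** The value at the corner (A + 1, B + 1) is arbitrary: the weight there cancels
in all the increments. *)
Definition box_rate (z : nat * nat) : R :=
  if z.2 == B.+1 then 1 - be else if z.1 == A.+1 then be else 1.

Lemma box_rate_gt0 z : 0 < box_rate z.
Proof.
by move: be01 => /andP[b0 b1]; rewrite /box_rate; case: ifP => _;
  [|case: ifP => _]; rewrite ?subr_gt0.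
Qed.

Variable X : nat * nat -> T -> R.
Hypothesis iX : indep_exp P box_rate X.

Let L u v t := lpp (fun a b => X (a, b) t) A.+1 B.+1 u v.

Definition horiz u v t := L u v t - L u.+1 v t.
Definition vert u v t := L u v t - L u v.+1 t.

(** Together with [vert_step]: filling in the site (u, v) is a flip of the
increments on its upper and right sides. *)
Lemma horiz_step u v t : (u <= A)%N -> (v <= B)%N ->
  horiz u v t = X (u, v) t + Num.max (horiz u v.+1 t - vert u.+1 v t) 0.
Proof.
move=> uA vB; rewrite /horiz /vert {1}/L lpp_step// -/(L u.+1 v t) -/(L u v.+1 t).
by case: (leP (L u.+1 v t) (L u v.+1 t)) => ?; case: leP => ?; lra.
Qed.

Lemma vert_step u v t : (u <= A)%N -> (v <= B)%N ->
  vert u v t = X (u, v) t + Num.max (vert u.+1 v t - horiz u v.+1 t) 0.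
Proof.
move=> uA vB; rewrite /horiz /vert {1}/L lpp_step// -/(L u.+1 v t) -/(L u v.+1 t).
by case: (leP (L u.+1 v t) (L u v.+1 t)) => ?; case: leP => ?; lra.
Qed.

(* The rows above v, and the columns from u on in row v, have been filled in. The
   slots of row B + 1 hold the current horizontal increments, and those of column
   A + 1 the vertical ones; unprocessed sites still hold their weights. *)
Let row_state v u := exists Y : nat * nat -> T -> R,
  [/\ indep_exp P box_rate Y,
     forall w, (w <= A)%N ->
       Y (w, B.+1) = if (w < u)%N then horiz w v.+1 else horiz w v,
     Y (A.+1, v) = vert u v,
     forall w, (w < u)%N -> Y (w, v) = X (w, v) &
     forall v' w, (v' < v)%N -> (w <= A.+1)%N -> Y (w, v') = X (w, v')].

Let row_flip v u : (v <= B)%N -> (u <= A)%N -> row_state v u.+1 -> row_state v u.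
Proof.
move=> vB uA [Y [iY Yh Yv Yx Yr]].
have ij : (u, B.+1) != (A.+1, v) :> nat * nat by rewrite xpair_eqE; lia.
have ik : (u, B.+1) != (u, v) :> nat * nat by rewrite xpair_eqE; lia.
have jk : (A.+1, v) != (u, v) :> nat * nat by rewrite xpair_eqE; lia.
exists (flip (u, B.+1) (A.+1, v) (u, v) Y).
have other z : z \notin [:: (u, B.+1); (A.+1, v); (u, v)] ->
    flip (u, B.+1) (A.+1, v) (u, v) Y z = Y z.
  by rewrite !inE !negb_or /flip => /and3P[/negbTE-> /negbTE-> /negbTE->].
split.
- apply: indep_exp_flip => //; first exact: box_rate_gt0.
  rewrite /box_rate/= !eqxx.
  have -> : (v == B.+1) = false by lia.
  have -> : (u == A.+1) = false by lia.
  by rewrite subrK.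
- move=> w wA; have [->|wu] := eqVneq w u.
    rewrite ltnn /flip eqxx; apply/funext => t.
    by rewrite horiz_step// Yh// ltnSn Yv Yx.
  rewrite other; last by rewrite !inE !xpair_eqE; lia.
  by rewrite Yh// ltnS leq_eqVlt (negbTE wu).
- rewrite /flip eq_sym (negbTE ij) eqxx; apply/funext => t.
  by rewrite vert_step// Yh// ltnSn Yv Yx.
- move=> w wu; rewrite other; last by rewrite !inE !xpair_eqE; lia.
  by rewrite Yx// ltnW.
- move=> v' w v'v wA; rewrite other; last by rewrite !inE !xpair_eqE; lia.
  by rewrite Yr.
Qed.

Let box_state v := exists Y : nat * nat -> T -> R,
  [/\ indep_exp P box_rate Y,
     forall w, (w <= A)%N -> Y (w, B.+1) = horiz w v,
     (v <= B)%N -> Y (A.+1, v) = vert 0 v &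
     forall v' w, (v' < v)%N -> (w <= A.+1)%N -> Y (w, v') = X (w, v')].

Let box_row v : (v <= B)%N -> box_state v.+1 -> box_state v.
Proof.
move=> vB [Y [iY Yh _ Yr]].
have : row_state v A.+1.
  exists Y; split => //.
  - by move=> w wA; rewrite Yh// ltnS wA.
  - rewrite Yr//; apply/funext => t; rewrite /vert /L lpp_side//.
    by rewrite addrK.
  - by move=> w wA; rewrite Yr// ltnW.
  - by move=> v' w v'v wA; rewrite Yr// ltnW.
have down n : (n <= A.+1)%N -> row_state v n -> row_state v 0.
  by elim: n => // n IH nA /row_flip => /(_ vB nA); apply: IH; exact: ltnW.
move=> /down => /(_ (leqnn _)) [Y' [iY' Yh' Yv' _ Yr']].
by exists Y'; split => // w wA; rewrite Yh'.
Qed.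

(** Burke's theorem: the increments along the bottom row inherit the joint law of
those on the top boundary. *)
Lemma burke_box : exists Y : nat * nat -> T -> R,
  [/\ indep_exp P box_rate Y,
     forall w, (w <= A)%N -> Y (w, B.+1) = horiz w 0 &
     Y (A.+1, 0) = vert 0 0].
Proof.
have : box_state B.+1.
  exists X; split => //; last by rewrite ltnn.
  by move=> w wA; apply/funext => t; rewrite /horiz /L lpp_top// addrK.
have down n : (n <= B.+1)%N -> box_state n -> box_state 0.
  by elim: n => // n IH nA /box_row => /(_ nA); apply: IH; exact: ltnW.
move=> /down => /(_ (leqnn _)) [Y [iY Yh Yv _]].
by exists Y; split => //; exact: Yv.
Qed.

End StationaryBox.

(** * Exponential moments of passage times *)

Section Moments.
Context d (T : measurableType d) (R : realType) (P : probability T R).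
Context (I : choiceType).
Implicit Types (X : I -> T -> R) (r : I -> R).

Lemma measurable_lpp d' (S : measurableType d') (w : nat -> nat -> S -> R) a b u v :
  (u <= a)%N -> (v <= b)%N ->
  (forall i j, (u <= i <= a)%N -> (v <= j <= b)%N -> measurable_fun setT (w i j)) ->
  measurable_fun setT (fun t => lpp (fun i j => w i j t) a b u v).
Proof.
move: u v; apply: quadrant_ind => [|u ua IH|v vb IH|u v ua vb IH1 IH2] mw.
- by under eq_fun do rewrite lpp_end; apply: mw; lia.
- under eq_fun do rewrite lpp_top//.
  apply: measurable_funD; first by apply: mw; lia.
  by apply: IH => i j ? ?; apply: mw; lia.
- under eq_fun do rewrite lpp_side//.
  apply: measurable_funD; first by apply: mw; lia.
  by apply: IH => i j ? ?; apply: mw; lia.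
- under eq_fun do rewrite lpp_step//.
  apply: measurable_funD; first by apply: mw; lia.
  apply: measurable_maxr; first by apply: IH1 => i j ? ?; apply: mw; lia.
  by apply: IH2 => i j ? ?; apply: mw; lia.
Qed.

Lemma mgf_add X r i (K : set I) F s : indep_exp P r X -> 0 < r i -> s < r i ->
  ~ K i -> known_by X K F ->
  (\int[P]_t (expR (s * (X i t + F t)))%:E =
   (r i / (r i - s))%:E * \int[P]_t (expR (s * F t))%:E)%E.
Proof.
move=> [iX lX] ri sr Ki kF; have [mX _] := iX.
have me : measurable_fun [set: R] (fun x => expR (s * x)).
  by apply: measurableT_comp.
have mF : measurable_fun setT F by exact: known_measurable kF.
rewrite -(exp_law_mgf ri sr (mX i) (lX i)).
rewrite -integral_indep_mul; last 5 first.
- exact: (measurableT_comp me (mX i)).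
- exact: (measurableT_comp me mF).
- apply: (@indep_pair_known _ _ _ P _ X [set i] K) => //.
  + by apply/seteqP; split => // l [/= ->].
  + have kc : known_by X [set i] (X i) by exact: known_coord.
    exact: (measurableT_comp me kc).
  + exact: (measurableT_comp me kF).
- by move=> t; exact: expR_ge0.
- by move=> t; exact: expR_ge0.
by apply: eq_integral => t _; rewrite mulrDr expRD.
Qed.

Lemma mgf_sum X r (f : nat -> I) n (al s : R) : indep_exp P r X -> injective f ->
  0 < al -> s < al -> (forall w, (w < n)%N -> r (f w) = al) ->
  (\int[P]_t (expR (s * \sum_(w < n) X (f w) t))%:E =
   ((al / (al - s)) ^+ n)%:E)%E.
Proof.
move=> iX fI al0 sal; have [[mX _] _] := iX.
elim: n => [|n IH] rf.
  under eq_integral do rewrite big_ord0 mulr0 expR0.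
  by rewrite integral_cst// mul1e expr0; exact: probability_setT.
transitivity (\int[P]_t (expR (s * (X (f n) t + \sum_(w < n) X (f w) t)))%:E)%E.
  by apply: eq_integral => t _; rewrite big_ord_recr/= addrC.
rewrite (@mgf_add X r (f n) [set f w | w in [set w | (w < n)%N]])//; last 4 first.
- by rewrite rf.
- by rewrite rf.
- by move=> [w /= wn /fI wE]; rewrite wE ltnn in wn.
- apply: measurable_sum => w.
  have kw : known_by X [set f w | w in [set w | (w < n)%N]] (X (f w)).
    by apply: known_coord; exists (w : nat) => /=.
  exact: kw.
rewrite IH; last by move=> w wn; rewrite rf// ltnW.
by rewrite rf// -EFinM exprS.
Qed.

Lemma chernoff_ge (F : T -> R) (s c : R) : measurable_fun setT F -> 0 < s ->
  (P [set t | c <= F t]%R <= \int[P]_t (expR (s * F t))%:E * (expR (- (s * c)))%:E)%E.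
Proof.
move=> mF s0.
pose G : {mfun T >-> R} := HB.pack F (isMeasurableFun.Build _ _ _ _ _ mF).
have := chernoff (P := P) G c s0; rewrite /mmt_gen_fun unlock.
by under eq_integral do rewrite /= mulrC.
Qed.

Lemma chernoff_le (F : T -> R) (s c : R) : measurable_fun setT F -> 0 < s ->
  (P [set t | F t <= c]%R <= \int[P]_t (expR (- s * F t))%:E * (expR (s * c))%:E)%E.
Proof.
move=> mF s0.
have mF' : measurable_fun setT (fun t => - F t) by exact: measurableT_comp.
have := @chernoff_ge _ s (- c) mF' s0.
under eq_integral do rewrite mulrN -mulNr.
by rewrite mulrN opprK; under eq_set do rewrite lerN2.
Qed.

End Moments.

Section LppMoments.
Context d (T : measurableType d) (R : realType) (P : probability T R).
Variable xi : nat * nat -> T -> R.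
Hypothesis ixi : indep_exp P (fun=> 1) xi.

Definition passage a b u v t := lpp (fun i j => xi (i, j) t) a b u v.

Lemma measurable_passage a b u v : (u <= a)%N -> (v <= b)%N ->
  measurable_fun setT (passage a b u v).
Proof. by move=> ua vb; apply: measurable_lpp => // i j _ _; have [[]] := ixi. Qed.

Lemma passage_known a b u v n : (u <= a)%N -> (v <= b)%N -> (n < u + v)%N ->
  known_by xi [set z | (n < z.1 + z.2)%N] (passage a b u v).
Proof.
move=> ua vb nuv; apply: measurable_lpp => // i j ui vj.
have k : known_by xi [set z | (n < z.1 + z.2)%N] (xi (i, j)).
  by apply: known_coord => /=; lia.
exact: k.
Qed.

(** Bounding the exponential of a maximum by the sum of the exponentials counts
all the paths. The bound solves the resulting recursion when
M / p + M / r <= 1, where M := 1 / (1 - s) is the moment of one weight; p is the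
cost of a horizontal step and r that of a vertical one. *)
Lemma passage_mgf (s p r : R) : 0 < s -> s < 1 ->
  (1 - s)^-1 <= p -> (1 - s)^-1 <= r -> (1 - s)^-1 * (p^-1 + r^-1) <= 1 ->
  forall a b u v, (u <= a)%N -> (v <= b)%N ->
  (\int[P]_t (expR (s * passage a b u v t))%:E <=
   ((1 - s)^-1 * p ^+ (a - u) * r ^+ (b - v))%:E)%E.
Proof.
have lt1 u v : (u + v < u.+1 + v)%N by rewrite addSn.
have lt2 u v : (u + v < u + v.+1)%N by rewrite addnS.
move=> s0 s1; set M := (1 - s)^-1 => Mp Mr Mpr a b.
have M0 : 0 < M by rewrite invr_gt0 subr_gt0.
have p0 : 0 < p by exact: lt_le_trans Mp.
have r0 : 0 < r by exact: lt_le_trans Mr.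
have [[mxi _] lxi] := ixi.
have add u v F : known_by xi [set z | (u + v < z.1 + z.2)%N] F ->
  (\int[P]_t (expR (s * (xi (u, v) t + F t)))%:E =
   M%:E * \int[P]_t (expR (s * F t))%:E)%E.
  move=> kF; rewrite (mgf_add ixi _ _ _ kF)//=; last by rewrite ltnn.
  by rewrite div1r.
have Mpq k l : 0 <= M * p ^+ k * r ^+ l.
  by rewrite !mulr_ge0 ?exprn_ge0 ?ltW.
apply: quadrant_ind => [|u ua IH|v vb IH|u v ua vb IH1 IH2].
- rewrite !subnn !mulr1; under eq_integral do rewrite /passage lpp_end.
  by rewrite (exp_law_mgf _ s1 (mxi _) (lxi _))// div1r.
- under eq_integral do rewrite /passage lpp_top//.
  rewrite add; last exact: passage_known.
  apply: (le_trans (lee_wpmul2l _ IH)); first by rewrite lee_fin ltW.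
  rewrite -EFinM lee_fin subnn !mulr1 -(subnSK ua) exprS.
  by rewrite ler_pM2l// ler_pM2r// exprn_gt0.
- under eq_integral do rewrite /passage lpp_side//.
  rewrite add; last exact: passage_known.
  apply: (le_trans (lee_wpmul2l _ IH)); first by rewrite lee_fin ltW.
  rewrite -EFinM lee_fin subnn !mulr1 -(subnSK vb) exprS.
  by rewrite ler_pM2l// ler_pM2r// exprn_gt0.
- under eq_integral do rewrite /passage lpp_step//.
  rewrite (add u v (fun t => Num.max (passage a b u.+1 v t) (passage a b u v.+1 t))); last first.
    by apply: measurable_maxr; apply: passage_known => //; exact: ltnW.
  have me : measurable_fun [set: R] (fun x => expR (s * x)).
    by apply: measurableT_comp.
  have m1 : measurable_fun setT (fun t => (expR (s * passage a b u.+1 v t))%:E).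
    apply/measurable_EFinP; apply: (measurableT_comp me).
    by apply: measurable_passage => //; exact: ltnW.
  have m2 : measurable_fun setT (fun t => (expR (s * passage a b u v.+1 t))%:E).
    apply/measurable_EFinP; apply: (measurableT_comp me).
    by apply: measurable_passage => //; exact: ltnW.
  have e0 x : (0 <= (expR (s * x))%:E)%E by rewrite lee_fin expR_ge0.
  have le12 : (\int[P]_t (expR (s * Num.max (passage a b u.+1 v t) (passage a b u v.+1 t)))%:E
      <= (M * p ^+ (a - u.+1) * r ^+ (b - v))%:E + (M * p ^+ (a - u) * r ^+ (b - v.+1))%:E)%E.
    apply: (le_trans _ (leeD IH1 IH2)).
    rewrite -ge0_integralD//.
    apply: ge0_le_integral => //.
    + apply/measurable_EFinP; apply: (measurableT_comp me).
      by apply: measurable_maxr; apply: measurable_passage => //; exact: ltnW.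
    + exact: emeasurable_funD.
    + move=> t _; rewrite -EFinD lee_fin.
      by case: (leP (passage a b u.+1 v t)) => _; [rewrite lerDr|rewrite lerDl]; exact: expR_ge0.
  apply: (le_trans (lee_wpmul2l _ le12)); first by rewrite lee_fin ltW.
  rewrite -EFinD -EFinM lee_fin.
  rewrite -(subnSK ua) -(subnSK vb).
  set k := (a - u.+1)%N; set l := (b - v.+1)%N.
  have -> : M * (M * p ^+ k * r ^+ l.+1 + M * p ^+ k.+1 * r ^+ l) =
    (M * (p^-1 + r^-1)) * (M * p ^+ k.+1 * r ^+ l.+1).
    rewrite !exprS; field.
    by rewrite (gt_eqF p0) (gt_eqF r0).
  by rewrite -[leRHS]mul1r ler_wpM2r.
Qed.

End LppMoments.

(** * Passage times in thin cones *)

Section Constants.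
Context (R : realType).
Variable be : R.
Hypotheses (be0 : 0 < be) (be1 : be < 2^-1).

(* kappa lies strictly between 1, the growth rate of G along the axis, and
   1 / (1 - be), that of the stationary model; s is the parameter of both Chernoff
   bounds. The horizontal cost 1 / (1 - s - delta) leaves room for a vertical cost
   1 / delta, and c > 1 for the slope of the cone. *)
Let kappa := 1 + be / 2.
Let s := be / 4.
Let delta := be * be / 100.
Let c := 1 + be * be / 100.

Lemma rate_sum_lt1 : expR (s * kappa) * ((1 - be) / (1 - be + s)) < 1.
Proof.
move: be0 be1 => b0 b1.
have s0 : 0 < s by rewrite /s; lra.
have e1 : 1 - s * kappa <= expR (- (s * kappa)) by exact: expR_ge1Dx.
have al0 : 0 < 1 - be + s by rewrite /s; lra.
rewrite mulrA ltr_pdivrMr// mul1r mulrC -ltr_pdivlMr ?expR_gt0// -expRN.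
rewrite (lt_le_trans _ (ler_wpM2l (ltW al0) e1))// /s /kappa.
by nra.
Qed.

Lemma rate_passage_lt1 : (1 - s - delta)^-1 * expR (- (s * kappa)) * c < 1.
Proof.
move: be0 be1 => b0 b1.
have e1 : 1 + s * kappa <= expR (s * kappa) by exact: expR_ge1Dx.
have d0 : 0 < 1 - s - delta by rewrite /s /delta; nra.
rewrite -mulrA ltr_pdivrMl// mulr1 mulrC expRN ltr_pdivrMr ?expR_gt0//.
rewrite (lt_le_trans _ (ler_wpM2l (ltW d0) e1))// /s /kappa /delta /c.
have -> : (1 - be / 4 - be * be / 100) * (1 + be / 4 * (1 + be / 2)) =
  1 + be * be * (1 / 8 - 1 / 16 - 1/100 - be * (1/32 + 1/400 + be /800)) by field.
suff : 1 / 100 < 1 / 8 - 1 / 16 - 1/100 - be * (1/32 + 1/400 + be /800) :> R.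
  by have := mulr_gt0 be0 be0; nra.
by nra.
Qed.

End Constants.

Section Tails.
Context d (T : measurableType d) (R : realType) (P : probability T R).

(** The vertical cost of b steps is absorbed by c ^ a when q b <= a and c ^ q is
large; the factor 2^-b keeps the bound summable over b. *)
Lemma exponential_tails (be : R) : 0 < be -> be < 2^-1 ->
  exists kappa rho : R, exists q : nat, [/\ 0 < rho, rho < 1, (0 < q)%N,
    forall (I : choiceType) (X : I -> T -> R) r (f : nat -> I) n,
      indep_exp P r X -> injective f -> (forall w, (w < n)%N -> r (f w) = 1 - be) ->
      (P [set t | \sum_(w < n) X (f w) t <= kappa * n%:R]%R <= (rho ^+ n)%:E)%E &
    forall (xi : nat * nat -> T -> R) a b, indep_exp P (fun=> 1) xi ->
      (0 < a)%N -> (q * b <= a)%N ->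
      (P [set t | kappa * a%:R <= passage xi a b 1 0 t]%R <=
        (rho ^+ a * 2^-1 ^+ b)%:E)%E].
Proof.
move=> be0 be1.
pose kappa := 1 + be / 2; pose s := be / 4.
pose delta := be * be / 100; pose c := 1 + be * be / 100.
have s0 : 0 < s by rewrite /s; lra.
have s1 : s < 1 by rewrite /s; lra.
have be2 : 0 < be * be by rewrite mulr_gt0.
have d0 : 0 < delta by rewrite /delta; lra.
have sd0 : 0 < 1 - s - delta by rewrite /s /delta; nra.
pose h1 := expR (s * kappa) * ((1 - be) / (1 - be + s)).
pose h2 := (1 - s - delta)^-1 * expR (- (s * kappa)) * c.
have h10 : 0 < h1.
  by rewrite /h1 mulr_gt0 ?expR_gt0// divr_gt0//; lra.
have h11 : h1 < 1 by exact: rate_sum_lt1.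
have h21 : h2 < 1 by exact: rate_passage_lt1.
have c0 : 0 < c by rewrite /c; lra.
have h20 : 0 < h2 by rewrite /h2 !mulr_gt0 ?expR_gt0// invr_gt0.
have [q q0 qc] : exists2 q, (0 < q)%N & 2 * delta^-1 <= c ^+ q.
  pose q := (Num.truncn (2 * delta^-1 / delta)).+1.
  exists q => //.
  have cq n : 1 + delta *+ n <= c ^+ n.
    elim: n => [|n IH]; first by rewrite mulr0n addr0.
    have cd : c = 1 + delta by [].
    have dn : 0 <= delta *+ n by rewrite mulrn_wge0// ltW.
    rewrite exprS mulrSr {1}cd mulrDl mul1r addrA lerD//.
    rewrite -{1}[delta]mulr1 ler_pM2l//.
    by apply: le_trans IH; rewrite lerDl.
  apply: le_trans (cq q).
  have : 2 * delta^-1 / delta < q%:R by exact: Num.Theory.truncnS_gt.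
  rewrite ltr_pdivrMr// [ltRHS]mulr_natl => /ltW/le_trans; apply.
  by rewrite lerDr.
exists kappa, (Num.max h1 h2), q; split => //.
- by rewrite lt_max h10.
- by rewrite gt_max h11.
- move=> I X r f n iX fI rf; have [[mX _] _] := iX.
  have mS : measurable_fun setT (fun t => \sum_(w < n) X (f w) t).
    by apply: measurable_sum => w; exact: mX.
  apply: (le_trans (chernoff_le P _ mS s0)).
  have al0 : 0 < 1 - be by lra.
  rewrite (mgf_sum iX fI al0 _ rf); last by lra.
  rewrite -EFinM lee_fin opprK.
  have -> : expR (s * (kappa * n%:R)) = expR (s * kappa) ^+ n.
    by rewrite -expRM_natl; congr expR; ring.
  rewrite -exprMn lerXn2r ?nnegrE//.
  + by rewrite mulr_ge0 ?expR_ge0// divr_ge0// ltW//; lra.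
  + by rewrite le_max (ltW h10).
  + by rewrite mulrC le_max lexx.
- move=> xi a b ixi a0 qba.
  have mG : measurable_fun setT (passage xi a b 1 0) by exact: (measurable_passage ixi).
  apply: (le_trans (chernoff_ge P _ mG s0)).
  have M0 : 0 < 1 - s by lra.
  have Mp : (1 - s)^-1 <= (1 - s - delta)^-1 by rewrite lef_pV2 ?posrE//; lra.
  have Mr : (1 - s)^-1 <= delta^-1.
    by rewrite lef_pV2 ?posrE// /delta /s; nra.
  have Mpr : (1 - s)^-1 * ((1 - s - delta)^-1^-1 + delta^-1^-1) <= 1.
    by rewrite !invrK subrK mulVf ?gt_eqF.
  have := passage_mgf ixi s0 s1 Mp Mr Mpr a0 (leq0n b).
  move=> /(lee_wpmul2r _) => /(_ (expR (- (s * (kappa * a%:R))))%:E) H.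
  apply: (le_trans (H _)); first by rewrite lee_fin expR_ge0.
  rewrite -EFinM lee_fin subn0.
  set p := (1 - s - delta)^-1 in Mp Mpr H *.
  have p0 : 0 < p by rewrite invr_gt0.
  have -> : expR (- (s * (kappa * a%:R))) = expR (- (s * kappa)) ^+ a.
    by rewrite -expRM_natl; congr expR; ring.
  have rb : delta^-1 ^+ b <= 2^-1 ^+ b * c ^+ a.
    have -> : delta^-1 = 2^-1 * (2 * delta^-1) by rewrite mulrA mulVf// mul1r.
    rewrite exprMn ler_pM2l ?exprn_gt0//.
    apply: (@le_trans _ _ ((c ^+ q) ^+ b)).
      by rewrite lerXn2r ?nnegrE ?mulr_ge0 ?exprn_ge0 ?invr_ge0// ltW.
    by rewrite -exprM ler_weXn2l// /c lerDl; lra.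
  have -> : (1 - s)^-1 * p ^+ (a - 1) * delta^-1 ^+ b * expR (- (s * kappa)) ^+ a =
    ((1 - s)^-1 * p ^+ (a - 1)) * (expR (- (s * kappa)) ^+ a * delta^-1 ^+ b) by ring.
  apply: (@le_trans _ _ (p ^+ a * (expR (- (s * kappa)) ^+ a * (2^-1 ^+ b * c ^+ a)))).
    apply: ler_pM => //.
    + by rewrite mulr_ge0 ?exprn_ge0// ?invr_ge0 ltW.
    + by rewrite mulr_ge0 ?exprn_ge0 ?expR_ge0 ?invr_ge0// ltW.
    + have -> : p ^+ a = p * p ^+ (a - 1) by rewrite subn1 -exprS prednK.
      by rewrite ler_pM2r ?exprn_gt0.
    + by rewrite ler_pM2l// exprn_gt0 ?expR_gt0.
  have -> : p ^+ a * (expR (- (s * kappa)) ^+ a * (2^-1 ^+ b * c ^+ a)) =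
     h2 ^+ a * 2^-1 ^+ b by rewrite /h2 !exprMn; ring.
  rewrite ler_pM2r ?exprn_gt0// lerXn2r ?nnegrE//.
  + exact: ltW.
  + by rewrite le_max (ltW h10).
  + by rewrite le_max lexx orbT.
Qed.

End Tails.

Section UnionBounds.
Context d (T : measurableType d) (R : realType) (P : probability T R).

Lemma prob_setU_le (A B : set T) (x y : R) : measurable A -> measurable B ->
  (P A <= x%:E)%E -> (P B <= y%:E)%E -> (P (A `|` B) <= (x + y)%:E)%E.
Proof.
by move=> mA mB Ax By; rewrite (le_trans (measureU2 P mA mB))// EFinD leeD.
Qed.

Lemma prob_bigcup_geometric (F : nat -> set T) N n (K rho : R) :
  0 <= K -> 0 < rho -> rho < 1 -> (forall i, measurable (F i)) ->
  (forall i, (N <= i < n)%N -> P (F i) <= (K * rho ^+ i)%:E)%E ->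
  (P (\bigcup_(i in [set i | (N <= i < n)%N]) F i) <= (K * rho ^+ N / (1 - rho))%:E)%E.
Proof.
move=> K0 r0 r1 mF; have r10 : 0 < 1 - rho by rewrite subr_gt0.
suff H m : (m <= n)%N -> (forall i, (N <= i < n)%N -> P (F i) <= (K * rho ^+ i)%:E)%E ->
    (P (\bigcup_(i in [set i | (N <= i < m)%N]) F i) <=
     (K * (rho ^+ N - rho ^+ (maxn N m)) / (1 - rho))%:E)%E.
  move=> PF; apply: (le_trans (H n (leqnn _) PF)); rewrite lee_fin.
  rewrite ler_pM2r ?invr_gt0// ler_wpM2l// lerBlDr lerDl.
  by rewrite exprn_ge0// ltW.
move=> + PF; elim: m => [_|m IH mn].
  rewrite maxn0 subrr mulr0 mul0r [X in P X](_ : _ = set0) ?measure0//.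
  by apply/seteqP; split => // t [i /=]; rewrite ltn0 andbF.
have {}IH := IH (ltnW mn).
have [Nm|mN] := leqP N m; last first.
  rewrite [X in P X](_ : _ = set0); last first.
    apply/seteqP; split => // t [i /= /andP[Ni]]; rewrite ltnS => im.
    by have := leq_trans Ni im; rewrite leqNgt mN.
  by rewrite measure0 lee_fin (maxn_idPl mN) subrr mulr0 mul0r.
rewrite [X in P X](_ : _ = \bigcup_(i in [set i | (N <= i < m)%N]) F i `|` F m); last first.
  apply/seteqP; split => t.
    move=> [i /= /andP[Ni]]; rewrite ltnS leq_eqVlt => /predU1P[->|im] Ft.
      by right.
    by left; exists i => //=; rewrite Ni.
  move=> [[i /= /andP[Ni im]] Ft|Ft]; first by exists i => //=; rewrite Ni ltnW.
  by exists m => //=; rewrite Nm /=.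
have Fm : (P (F m) <= (K * rho ^+ m)%:E)%E by apply: PF; rewrite Nm.
apply: (le_trans (prob_setU_le _ _ IH Fm)) => //.
  exact: bigcup_measurable.
rewrite lee_fin (maxn_idPr (leq_trans Nm (leqnSn m))) (maxn_idPr Nm).
have -> : K * rho ^+ m = K * (rho ^+ m * (1 - rho)) / (1 - rho).
  by rewrite mulrA mulfK// gt_eqF.
by rewrite -mulrDl -mulrDr ler_pM2r ?invr_gt0// ler_wpM2l// exprS; lra.
Qed.

End UnionBounds.

Section Box.
Context d (T : measurableType d) (R : realType) (P : probability T R).
Implicit Types (xi : nat * nat -> T -> R).

Definition goes_up xi q N A := [set t | exists a b,
  [/\ (N <= a < A)%N, (0 < b)%N, (q * b <= a)%N &
      passage xi a b 1 0 t <= passage xi a b 0 1 t]].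

Lemma measurable_goes_up xi q N A : indep_exp P (fun=> 1) xi -> (0 < N)%N ->
  measurable (goes_up xi q N A).
Proof.
move=> ixi N0.
rewrite [X in measurable X](_ : _ =
  \bigcup_(a in [set a | (N <= a < A)%N]) \bigcup_(b in [set b | (0 < b)%N /\ (q * b <= a)%N])
    [set t | passage xi a b 1 0 t <= passage xi a b 0 1 t]).
  apply: bigcup_measurable => a /= /andP[Na _].
  apply: bigcup_measurable => b /= [b0 _].
  rewrite -[X in measurable X]setTI; apply: measurable_fun_le => //.
    by apply: (measurable_passage ixi) => //; exact: leq_trans Na.
  by apply: (measurable_passage ixi).
apply/seteqP; split => t.
  by move=> [a [b [? ? ? ?]]]; exists a => //; exists b.
by move=> [a ? [b [? ?] ?]]; exists a, b.
Qed.

Lemma indep_exp_scale xi (r : nat * nat -> R) : indep_exp P (fun=> 1) xi ->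
  (forall z, 0 < r z) -> indep_exp P r (fun z t => xi z t / r z).
Proof.
move=> [[mxi indxi] lxi] r0; split; last first.
  by move=> z; exact: (exp_law_scale (r0 z) (mxi z) (lxi z)).
have mr z : measurable_fun [set: R] (fun x => x / r z) by exact: mulrr_measurable.
split; first by move=> z; apply: measurable_funM.
move=> s B us mB.
rewrite (_ : \bigcap_(i in [set` s]) _ =
   \bigcap_(i in [set` s]) (xi i @^-1` ((fun x => x / r i) @^-1` B i)))//.
by rewrite indxi// => i; exact: measurable_preimage.
Qed.

Lemma telescope_horiz xi A B n t : (n <= A)%N ->
  \sum_(w < n) horiz A B xi w.+1 0 t =
  lpp (fun i j => xi (i, j) t) A.+1 B.+1 1 0 - lpp (fun i j => xi (i, j) t) A.+1 B.+1 n.+1 0.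
Proof.
elim: n => [|n IH] nA; first by rewrite big_ord0 subrr.
by rewrite big_ord_recr/= IH 1?ltnW// /horiz addrA subrK.
Qed.

(** Apart from the tails of the geometric series, an upward preference somewhere
in the cone implies L(1, 0) <= L(0, 1), hence that L(0, 0) - L(0, 1) equals the
weight at the origin: the former is at most s, or the latter exceeds s. The
bound is uniform in the size A of the box. *)
Lemma goes_up_bound (be : R) : 0 < be -> be < 2^-1 ->
  exists rho : R, exists q : nat, [/\ 0 < rho, rho < 1, (0 < q)%N &
   forall xi s N A, indep_exp P (fun=> 1) xi -> 0 <= s -> (0 < N)%N ->
   (P (goes_up xi q N A) <=
     (1 - expR (- be * s) + expR (- s) + 2 * (rho ^+ N / (1 - rho)))%:E)%E].
Proof.
move=> be0 be1; have [kappa [rho [q [r0 r1 q0 Hsum Hpas]]]] := exponential_tails P be0 be1.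
exists rho, q; split => // xi s N A ixi s0 N0.
have be01 : 0 < be < 1 by rewrite be0/=; lra.
have r10 : 0 < 1 - rho by rewrite subr_gt0.
pose rate := box_rate be A A.
(* The boundary weights are rescaled copies of the weights at the same sites, so
   that no further randomness is needed. *)
pose X z t := xi z t / rate z.
have iX : indep_exp P rate X.
  by apply: indep_exp_scale => // z; exact: box_rate_gt0.
have [Y [iY Yh Yv]] := burke_box be01 iX.
have [[mxi _] lxi] := ixi; have [[mY _] lY] := iY.
pose S n t := \sum_(w < n) Y (w.+1, A.+1) t.
have mS n : measurable_fun setT (S n) by apply: measurable_sum => w; exact: mY.
(* E0: a negative weight; E1 and E2: the increment at the origin is small or the
   weight there is large; E3: the stationary model grows too slowly; E4: passage
   times in the cone grow too fast. *)
pose E0 := \bigcup_i \bigcup_j xi (i, j) @^-1` `]-oo, 0[.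
pose E1 := ~` (Y (A.+1, 0) @^-1` `]s, +oo[).
pose E2 := xi (0, 0) @^-1` `]s, +oo[.
pose E3 := \bigcup_(a in [set a | (N <= a < A)%N]) [set t | S a t <= kappa * a%:R].
pose F a b := if (0 < a)%N && (q * b <= a)%N
  then [set t | kappa * a%:R <= passage xi a b 1 0 t] else set0.
pose E4 := \bigcup_(a in [set a | (N <= a < A)%N]) \bigcup_(b in [set b | (1 <= b < a.+1)%N]) F a b.
have m0 : measurable E0.
  by do 2 apply: bigcupT_measurable => ?; exact: measurable_preimage.
have m1 : measurable E1 by apply: measurableC; exact: measurable_preimage.
have m2 : measurable E2 by exact: measurable_preimage.
have mS' a : measurable [set t | S a t <= kappa * a%:R].
  by rewrite -[X in measurable X]setTI; apply: measurable_fun_le.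
have m3 : measurable E3 by exact: bigcup_measurable.
have mF a b : measurable (F a b).
  rewrite /F; case: ifP => // /andP[a0 _].
  rewrite -[X in measurable X]setTI; apply: measurable_fun_le => //.
  exact: (measurable_passage ixi).
have m4 : measurable E4 by apply: bigcup_measurable => a _; exact: bigcup_measurable.
have P0 : (P E0 <= 0%:E)%E.
  have PE : P E0 = 0%E.
    apply/negligibleP => //; apply: negligible_bigcup => i.
    apply: negligible_bigcup => j; apply/negligibleP; first exact: measurable_preimage.
    exact: (exp_law_ge0 ltr01 (mxi _) (lxi _)).
  by rewrite PE.
have P1 : (P E1 <= (1 - expR (- be * s))%:E)%E.
  rewrite probability_setC; last exact: measurable_preimage.
  have lv : exp_law_of P be (Y (A.+1, 0)).
    by have := lY (A.+1, 0); rewrite /rate /box_rate/= eqxx.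
  by rewrite (exp_law_tail be0 (mY _) lv).
have P2 : (P E2 <= (expR (- s))%:E)%E.
  by rewrite (exp_law_tail ltr01 (mxi _) (lxi _))// mulN1r.
have P3 : (P E3 <= (1 * rho ^+ N / (1 - rho))%:E)%E.
  apply: prob_bigcup_geometric => // a /andP[Na aA]; rewrite mul1r.
  apply: (Hsum _ _ _ (fun w => (w.+1, A.+1)) a iY); first by move=> ? ? [].
  by move=> w wa; rewrite /rate /box_rate/= eqxx.
have P4 : (P E4 <= (1 * rho ^+ N / (1 - rho))%:E)%E.
  apply: prob_bigcup_geometric => // [a|a /andP[Na aA]]; first exact: bigcup_measurable.
  have a0 : (0 < a)%N by exact: leq_trans Na.
  have h2 : (2^-1 : R) < 1 by lra.
  apply: (@le_trans _ _ ((rho ^+ a * 2^-1 ^+ 1 / (1 - 2^-1))%:E)).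
    apply: prob_bigcup_geometric => //; first by rewrite exprn_ge0// ltW.
    move=> b _; rewrite /F; case: ifP => [/andP[_ qba]|_]; first exact: Hpas.
    by rewrite measure0 lee_fin mulr_ge0 ?exprn_ge0// ?invr_ge0// ltW.
  have -> : 1 - 2^-1 = 2^-1 :> R by lra.
  by rewrite lee_fin mul1r expr1 mulfK.
have sub : goes_up xi q N A `<=` E0 `|` (E1 `|` (E2 `|` (E3 `|` E4))).
  move=> t [a [b [/andP[Na aA] b0 qba up]]].
  have a0 : (0 < a)%N by exact: leq_trans Na.
  have ba : (b <= a)%N by apply: leq_trans qba; rewrite leq_pmull.
  have bA : (b < A)%N by exact: leq_ltn_trans aA.
  have aA1 : (a < A.+1)%N by exact: leqW.
  have bA1 : (b < A.+1)%N by exact: leqW.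
  apply: contrapT => /not_orP[nE0 /not_orP[nE1 /not_orP[nE2 /not_orP[nE3 nE4]]]].
  have X0 i j : 0 <= X (i, j) t.
    rewrite /X divr_ge0//; last exact/ltW/box_rate_gt0.
    rewrite leNgt; apply/negP => xi0; apply: nE0; exists i => //; exists j => //=.
  have G_X u v : (u <= a)%N -> (v <= b)%N ->
      lpp (fun i j => X (i, j) t) a b u v = passage xi a b u v t.
    move=> ua vb; apply: lpp_ext => // i j ia jb; rewrite /X /rate /box_rate/=.
    have /andP[_ {}ia] := ia; have /andP[_ {}jb] := jb.
    rewrite (ltn_eqF (leq_ltn_trans ia aA1)) (ltn_eqF (leq_ltn_trans jb bA1)).
    by rewrite divr1.
  have := exit_dichotomy X0 aA1 bA1 a0 b0; rewrite !G_X//.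
  set L := lpp (fun i j => X (i, j) t) A.+1 A.+1 => dich.
  have Sle : passage xi a b 1 0 t < S a t.
    have h3 : kappa * a%:R < S a t.
      rewrite ltNge; apply/negP => h; apply: nE3; exists a => //=.
      by rewrite Na.
    apply: lt_trans h3; rewrite ltNge; apply/negP => h; apply: nE4.
    exists a => /=; first by rewrite Na.
    by exists b => /=; rewrite ?b0 ?ltnS// /F a0 qba.
  have SE : S a t = L 1 0 - L a.+1 0.
    rewrite /L -telescope_horiz 1?ltnW//; apply: eq_bigr => w _; rewrite Yh//.
    exact: leq_trans (ltn_ord w) (ltnW aA).
  have V : s < L 0 0 - L 0 1.
    have := nE1; rewrite /E1/= Yv => /contrapT; rewrite in_itv/= andbT.
    by rewrite /vert.
  have X00 : X (0, 0) t <= s.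
    have := nE2; rewrite /E2/= in_itv/= andbT => /negP; rewrite -leNgt.
    by rewrite /X /rate /box_rate/= divr1.
  have L00 : L 0 0 = X (0, 0) t + Num.max (L 1 0) (L 0 1) by rewrite /L lpp_step.
  have L10 : L 0 1 < L 1 0.
    by move: V; rewrite L00; case: (leP (L 1 0) (L 0 1)) => // _; lra.
  by case: dich => dich; lra.
apply: (@le_trans _ _ (P (E0 `|` (E1 `|` (E2 `|` (E3 `|` E4)))))).
  apply: le_measure => //; rewrite inE; first exact: measurable_goes_up.
  by do 4 apply: measurableU => //.
have -> : 1 - expR (- be * s) + expR (- s) + 2 * (rho ^+ N / (1 - rho)) =
  0 + (1 - expR (- be * s) + (expR (- s) +
   (1 * rho ^+ N / (1 - rho) + 1 * rho ^+ N / (1 - rho)))).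
  by rewrite !mul1r; ring.
do 4 (apply: prob_setU_le => //; try by do ?apply: measurableU => //).
Qed.

End Box.

Section AlmostSure.
Context d (T : measurableType d) (R : realType) (P : probability T R).
Implicit Types (xi : nat * nat -> T -> R).

Lemma goes_up_vanishing xi (e : R) : indep_exp P (fun=> 1) xi -> 0 < e ->
  exists q N : nat, [/\ (0 < q)%N, (0 < N)%N &
    (P (\bigcup_A goes_up xi q N A) <= e%:E)%E].
Proof.
move=> ixi e0.
(* exp(- s) <= 1 / (1 + s) <= e / 3 and 1 - exp(- be s) <= be s <= e / 3. *)
pose s := 3 / e.
have s0 : 0 < s by rewrite divr_gt0.
have es : expR (- s) <= e / 3.
  rewrite expRN invf_ple ?posrE ?expR_gt0 ?divr_gt0// invf_div -/s.
  by apply: le_trans (expR_ge1Dx s); lra.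
pose be := Num.min 4^-1 (e / 3 / s).
have be0 : 0 < be by rewrite lt_min divr_gt0 ?divr_gt0//= andbT invr_gt0.
have be1 : be < 2^-1 by rewrite gt_min; apply/orP; left; lra.
have bes : 1 - expR (- be * s) <= e / 3.
  apply: (@le_trans _ _ (be * s)).
    by have := expR_ge1Dx (- be * s); lra.
  by rewrite -ler_pdivlMr// ge_min lexx orbT.
have [rho [q [r0 r1 q0 H]]] := goes_up_bound P be0 be1.
have r10 : 0 < 1 - rho by rewrite subr_gt0.
have [N N0 rN] : exists2 N, (0 < N)%N & 2 * (rho ^+ N / (1 - rho)) <= e / 3.
  have : rho ^+ n @[n --> \oo] --> 0 by apply: cvg_expr; rewrite ger0_norm// ltW.
  move=> /cvgrPdist_le /(_ (e / 6 * (1 - rho))) []; first by rewrite mulr_gt0// divr_gt0.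
  move=> N _ rN; exists N.+1 => //; have := rN N.+1 (leqnSn N).
  rewrite /= sub0r normrN ger0_norm => [h|]; last by rewrite exprn_ge0// ltW.
  have : rho ^+ N.+1 / (1 - rho) <= e / 6 by rewrite ler_pdivrMr.
  lra.
exists q, N; split => //.
have mG A : measurable (goes_up xi q N A) by exact: (measurable_goes_up _ _ ixi).
have nd : nondecreasing_seq (goes_up xi q N).
  move=> A A' AA'; apply/subsetPset => t [a [b [/andP[Na aA] b0 qb up]]].
  by exists a, b; split => //; rewrite Na (leq_trans aA).
have cv : P \o goes_up xi q N @ \oo --> P (\bigcup_A goes_up xi q N A).
  by apply: nondecreasing_cvg_mu => //; exact: bigcupT_measurable.
rewrite -(cvg_lim _ cv)//; apply: lime_le.
  by apply/cvg_ex; eexists; exact: cv.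
apply: nearW => A; apply: (le_trans (H xi s N A ixi (ltW s0) N0)).
by rewrite lee_fin; lra.
Qed.

Lemma ae_goes_right xi : indep_exp P (fun=> 1) xi ->
  {ae P, forall t, exists q N, forall a b, (N <= a)%N -> (0 < b)%N ->
     (q * b <= a)%N -> passage xi a b 0 1 t < passage xi a b 1 0 t}.
Proof.
move=> ixi.
pose Bad := \bigcap_(q in [set q | (0 < q)%N]) \bigcap_(N in [set N | (0 < N)%N])
  \bigcup_A goes_up xi q N A.
have mU q N : (0 < N)%N -> measurable (\bigcup_A goes_up xi q N A).
  by move=> N0; apply: bigcupT_measurable => A; exact: (measurable_goes_up _ _ ixi).
have mBad : measurable Bad.
  apply: bigcap_measurable; first by exists 1%N.
  move=> q _; apply: bigcap_measurable; first by exists 1%N.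
  by move=> N /= N0; exact: mU.
exists Bad; split => //.
  apply/eqP; rewrite eq_le measure_ge0 andbT; apply/lee_addgt0Pr => e e0.
  rewrite add0e; have [q [N [q0 N0 PqN]]] := goes_up_vanishing ixi e0.
  apply: le_trans PqN; apply: le_measure; rewrite ?inE//; first exact: mU.
  by move=> t /(_ q q0) /(_ N N0).
move=> t /=; apply: contra_notP.
rewrite /Bad => /existsNP[q /not_implyP[q0 /existsNP[N /not_implyP[N0 nup]]]].
exists q, N => a b Na b0 qb; rewrite ltNge; apply/negP => up; apply: nup.
by exists a.+1 => //; exists a, b; split => //; rewrite Na /=.
Qed.

End AlmostSure.

(** * Geodesics in the lattice *)

Section Lattice.
Local Notation Z2 := (int * int)%type.
Implicit Types (x y : Z2) (i a b u v : nat).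

(** The site x + a e_i + b e_(3 - i): coordinates relative to x in which the
direction under study comes first, so that both values of i are treated at
once. *)
Definition site (x : Z2) i a b : Z2 :=
  if i == 1%N then (x.1 + a%:Z, x.2 + b%:Z) else (x.1 + b%:Z, x.2 + a%:Z).

Lemma site00 x i : site x i 0 0 = x.
Proof. by rewrite /site; case: ifP => _; rewrite !addr0; case: x. Qed.

Lemma site_inj x i a b a' b' : site x i a b = site x i a' b' -> a = a' /\ b = b'.
Proof. by rewrite /site; case: ifP => _ [] h1 h2; split; lia. Qed.

Lemma upright_siteP x i a b y :
  reflect (y = site x i a.+1 b \/ y = site x i a b.+1) (upright_step (site x i a b) y).
Proof.
apply: (iffP orP); case: y => y1 y2; rewrite /site /basis_vec.
  by case: ifP => _ [] /eqP [] /= h1 h2; [left|right|right|left]; congr pair; lia.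
case: ifP => _ [] [] -> ->; [left|right|right|left]; apply/eqP; congr pair => /=; lia.
Qed.

Lemma site_step1 x i a b : i \in [:: 1%N; 2%N] ->
  site x i a.+1 b = site x i a b + basis_vec i.
Proof.
by rewrite !inE => /orP[]/eqP->; rewrite /site /basis_vec/=; congr pair => /=; lia.
Qed.

Lemma site_step2 x i a b : i \in [:: 1%N; 2%N] ->
  site x i a b.+1 = site x i a b + basis_vec (3 - i).
Proof.
by rewrite !inE => /orP[]/eqP->; rewrite /site /basis_vec/=; congr pair => /=; lia.
Qed.

Lemma dot_site x i a b : i \in [:: 1%N; 2%N] ->
  dot (site x i a b) (basis_vec (3 - i)) = dot x (basis_vec (3 - i)) + b%:Z.
Proof. by rewrite !inE => /orP[]/eqP->; rewrite /site /basis_vec/dot/=; lia. Qed.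

Lemma path_site x i a b p : path upright_step (site x i a b) p ->
  exists a' b', [/\ (a <= a')%N, (b <= b')%N & last (site x i a b) p = site x i a' b'].
Proof.
elim: p a b => [|y p IH] a b /=; first by exists a, b.
case/andP=> /upright_siteP[]-> /IH[a' [b' [aa' bb' ->]]]; exists a', b'; split => //.
  exact: ltnW.
exact: ltnW.
Qed.

End Lattice.

Section Paths.
Context (R : realType).
Variables (w : int * int -> R) (x : int * int) (i : nat).
Let w' a b := w (site x i a b).

Lemma passage_time_cons z p : passage_time w (z :: p) = w z + passage_time w p.
Proof. by rewrite /passage_time big_cons. Qed.

Lemma passage_time_le_lpp a b u v p : path upright_step (site x i u v) p ->
  last (site x i u v) p = site x i a b ->
  passage_time w (site x i u v :: p) <= lpp w' a b u v.
Proof.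
elim: p u v => [|y p IH] u v /=.
  move=> _ /site_inj[-> ->].
  by rewrite passage_time_cons /passage_time big_nil addr0 lpp_end.
case/andP=> /upright_siteP H yp lastp; rewrite passage_time_cons.
have bound u' v' : y = site x i u' v' -> (u' <= a)%N /\ (v' <= b)%N.
  move=> yE; move: yp lastp; rewrite yE => /path_site[a' [b' [ua' vb' ->]]].
  by move=> /site_inj[<- <-].
case: H => yE; have [ua vb] := bound _ _ yE.
- rewrite yE in yp lastp *; have {}IH := IH _ _ yp lastp.
  move: vb; rewrite leq_eqVlt => /predU1P[vE|vb].
    by subst v; rewrite lpp_top// lerD2l.
  by rewrite lpp_step// lerD2l le_max IH.
- rewrite yE in yp lastp *; have {}IH := IH _ _ yp lastp.
  move: ua; rewrite leq_eqVlt => /predU1P[uE|ua].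
    by subst u; rewrite lpp_side// lerD2l.
  by rewrite lpp_step// lerD2l le_max IH orbT.
Qed.

Lemma lpp_attained a b u v : (u <= a)%N -> (v <= b)%N ->
  exists p, [/\ path upright_step (site x i u v) p,
    last (site x i u v) p = site x i a b &
    passage_time w (site x i u v :: p) = lpp w' a b u v].
Proof.
have right u' v' p : path upright_step (site x i u'.+1 v') p ->
    path upright_step (site x i u' v') (site x i u'.+1 v' :: p).
  by move=> pp /=; rewrite pp andbT; apply/upright_siteP; left.
have up u' v' p : path upright_step (site x i u' v'.+1) p ->
    path upright_step (site x i u' v') (site x i u' v'.+1 :: p).
  by move=> pp /=; rewrite pp andbT; apply/upright_siteP; right.
move: u v; apply: quadrant_ind => [|u ua [p [pp lp Wp]]
  |v vb [p [pp lp Wp]]|u v ua vb [p [pp lp Wp]] [p' [pp' lp' Wp']]].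
- by exists [::]; rewrite lpp_end passage_time_cons /passage_time big_nil addr0.
- by exists (site x i u.+1 b :: p); rewrite lpp_top// passage_time_cons Wp;
    split => //; exact: right.
- by exists (site x i a v.+1 :: p); rewrite lpp_side// passage_time_cons Wp; split => //; exact: up.
- rewrite lpp_step// -Wp -Wp'.
  case: (leP (passage_time w (site x i u.+1 v :: p))) => _.
    by exists (site x i u v.+1 :: p'); rewrite passage_time_cons; split => //; exact: up.
  by exists (site x i u.+1 v :: p); rewrite passage_time_cons; split => //; exact: right.
Qed.

End Paths.

Section Geodesics.
Context (R : realType).
Variables (w : int * int -> R) (i : nat) (g : nat -> int * int).
Hypothesis iP : i \in [:: 1%N; 2%N].

Lemma upright_site_path n k u v x : (forall k, upright_step (g k) (g k.+1)) ->
  g k = site x i u v ->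
  exists a b, [/\ (u <= a)%N, (v <= b)%N, (a + b = u + v + n)%N & g (k + n)%N = site x i a b].
Proof.
move=> ug gk; elim: n => [|n [a [b [ua vb abn gn]]]].
  by exists u, v; rewrite !addn0.
have := ug (k + n)%N; rewrite gn => /upright_siteP[] gS; rewrite (addnS k n) gS.
- by exists a.+1, b; split => //; lia.
- by exists a, b.+1; split => //; lia.
Qed.

(** A geodesic through x which steps by e_(3 - i) there attests, at each of its
later sites, that going on by e_i is not better. *)
Lemma geodesic_turn k0 k : semi_infinite_geodesic w g ->
  g k0.+1 = g k0 + basis_vec (3 - i) -> (k0 < k)%N ->
  exists a b, [/\ (0 < b)%N, (a + b = k - k0)%N, g k = site (g k0) i a b &
    (0 < a)%N -> lpp (fun a b => w (site (g k0) i a b)) a b 1 0 <=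
      lpp (fun a b => w (site (g k0) i a b)) a b 0 1].
Proof.
move=> [ug geo] turn k0k; set x := g k0.
have gS : g k0.+1 = site x i 0 1 by rewrite site_step2// site00.
have [a [b [_ b0 abk gk]]] := upright_site_path (k - k0.+1) ug gS.
have kE : (k0.+1 + (k - k0.+1))%N = k by lia.
rewrite kE in gk; exists a, b; split => //; first by lia.
move=> a0; have [[p [sE pp lp]] Wmax] := geo _ _ k0k.
have [_ lmax] : (exists s, is_geodesic w x (g k) s) /\
    (forall s, upright_paths x (g k) s -> passage_time w s <= last_passage_time w x (g k)).
  by apply: last_passage_time_max; rewrite gk /site; case: ifP => _ /=; lia.
have pE : exists p', p = g k0.+1 :: p'.
  move: sE; rewrite /path_segment -[(k - k0)%N](_ : (k - k0.+1).+1 = _)//; last by lia.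
  by rewrite /= => -[<-]; eexists; reflexivity.
move: pE => [p' pE]; subst p; move: pp lp => /= /andP[_ pp] lp.
have [p2 [pp2 lp2 Wp2]] := lpp_attained w x i a0 (leq0n b).
have le1 : passage_time w (x :: site x i 1 0 :: p2) <= last_passage_time w x (g k).
  apply: lmax; exists (site x i 1 0 :: p2); split => //=; last by rewrite lp2.
  rewrite pp2 andbT -{1}[x](site00 x i); apply/upright_siteP; by left.
rewrite -Wmax sE !(passage_time_cons _ x) lerD2l Wp2 in le1.
apply: (le_trans le1); rewrite gS; apply: passage_time_le_lpp.
  by rewrite -gS.
by rewrite -gS lp.
Qed.

End Geodesics.

Lemma limn_einf0_frequently (R : realType) (u : nat -> \bar R) (e : R) K :
  limn_einf u = 0%E -> 0 < e -> exists2 k, (K <= k)%N & (u k < e%:E)%E.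
Proof.
rewrite limn_einf_lim (cvg_lim _ (@cvg_einfs_sup _ u))// => u0 e0.
have : (einfs u K < e%:E)%E.
  apply: (@le_lt_trans _ _ 0%E); last by rewrite lte_fin.
  by rewrite -u0; apply: ereal_sup_ubound; exists K.
by move=> /ereal_inf_lt[_ [k /= Kk <-] uk]; exists k.
Qed.

Section Straight.
Context (R : realType).
Variables (w : int * int -> R) (i : nat).
Hypothesis iP : i \in [:: 1%N; 2%N].
Implicit Types (x : int * int) (g : nat -> int * int).

Lemma site_ray x k : site x i k 0 = x + basis_vec i *+ k.
Proof.
elim: k => [|k IH]; first by rewrite site00 mulr0n addr0.
by rewrite site_step1// IH mulrSr addrA.
Qed.

Lemma unique_straight_path x a b u p : path upright_step (site x i u b) p ->
  last (site x i u b) p = site x i a b ->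
  p = [seq site x i k b | k <- iota u.+1 (a - u)].
Proof.
elim: p u => [|y p IH] u /=; first by move=> _ /site_inj[-> _]; rewrite subnn.
case/andP=> /upright_siteP[]-> yp lp.
  have ua : (u < a)%N.
    by move: (path_site yp) => [a' [b' [ua' _]]]; rewrite lp => /site_inj[-> _].
  by rewrite -(subnSK ua)/= -IH.
move: (path_site yp) => [a' [b' [_ bb']]]; rewrite lp => /site_inj[_ bE].
by rewrite -bE ltnn in bb'.
Qed.

Lemma straight_geodesic x : semi_infinite_geodesic w (fun k => x + basis_vec i *+ k).
Proof.
have rE k : x + basis_vec i *+ k = site x i k 0 by rewrite site_ray.
split=> [k|m n mn].
  by rewrite !rE; apply/upright_siteP; left.
have [[s [[p [sE pp lp]] Ws]] _] : (exists s, is_geodesic w (site x i m 0) (site x i n 0) s) /\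
    (forall s, upright_paths (site x i m 0) (site x i n 0) s ->
       passage_time w s <= last_passage_time w (site x i m 0) (site x i n 0)).
  by apply: last_passage_time_max; rewrite /site; case: ifP => _ /=; lia.
have -> : path_segment (fun k => x + basis_vec i *+ k) m n = s.
  rewrite sE (unique_straight_path pp lp) /path_segment /= rE.
  by congr cons; apply: eq_map => k; rewrite rE.
rewrite !rE; split => //.
by exists p.
Qed.

Lemma ray_limn_einf x :
  limn_einf (fun k : nat => (k%:R^-1 *
    (dot (x + basis_vec i *+ k) (basis_vec (3 - i)))%:~R : R)%:E) = 0%E.
Proof.
pose c : R := (dot x (basis_vec (3 - i)))%:~R.
have cv : (fun k : nat => k%:R^-1 * c) @ \oo --> (0 : R).
  rewrite -[X in _ --> X](mul0r c); apply: cvgM; last exact: cvg_cst.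
  apply/gtr0_cvgV0; last exact: cvgr_idn.
  by near=> k; rewrite ltr0n; near: k; exists 1%N.
have {}cv : (fun k : nat => (k%:R^-1 * c)%:E) @ \oo --> (0 : R)%:E.
  by apply: cvg_EFin => //; exact: nearW.
rewrite [X in limn_einf X](_ : _ = (fun k : nat => (k%:R^-1 * c)%:E)).
  by have [-> _] := cvg_limn_einf_sup cv.
apply/funext => k.
by rewrite -site_ray dot_site// addr0.
Unshelve. all: by end_near. Qed.

(** After a step in the transverse direction the geodesic would have to avoid the
cone, but its liminf slope is 0. *)
Lemma geodesic_straight g x : 0 <= x.1 -> 0 <= x.2 ->
  (forall y, exists q N, forall a b, (N <= a)%N -> (0 < b)%N -> (q * b <= a)%N ->
    lpp (fun a b => w (site y i a b)) a b 0 1 < lpp (fun a b => w (site y i a b)) a b 1 0) ->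
  semi_infinite_geodesic w g -> g 0%N = x ->
  limn_einf (fun k : nat =>
     (k%:R^-1 * (dot (g k) (basis_vec (3 - i)))%:~R : R)%:E) = 0%E ->
  g = fun k => x + basis_vec i *+ k.
Proof.
move=> x1 x2 right geo g0 ginf; have [ug _] := geo.
suff straight k : g k.+1 = g k + basis_vec i.
  apply/funext; elim=> [|k IH]; first by rewrite mulr0n addr0.
  by rewrite straight IH mulrSr addrA.
have := ug k; rewrite -{1}[g k](site00 _ i) => /upright_siteP[] gk.
  by rewrite gk site_step1// site00.
exfalso.
rewrite site_step2// site00 in gk.
have [q [N qN]] := right (g k).
have dg : 0 <= dot (g k) (basis_vec (3 - i)).
  have g0s : g 0%N = site x i 0 0 by rewrite site00.
  have [a [b [_ _ _ ->]]] := upright_site_path iP k ug g0s.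
  rewrite dot_site//.
  by move: iP; rewrite !inE /dot => /orP[]/eqP-> /=; lia.
(* A transverse displacement b < n / (2 (q + 1)) at a time n >= 2 (k + N) leaves
   a = n - k - b >= q b and a > N. *)
pose M := (2 * q.+1)%N.
have M0 : 0 < M%:R^-1 :> R by rewrite invr_gt0 ltr0n.
have [n nK] := limn_einf0_frequently (k + (2 * k + 2 * N)).+1 ginf M0.
rewrite lte_fin => dn.
have kn : (k < n)%N by apply: leq_trans nK; lia.
have [a [b [b0 abn gn turn]]] := geodesic_turn iP geo gk kn.
have Mb : (M * b < n)%N.
  have n0 : 0 < n%:R :> R by rewrite ltr0n; apply: leq_trans kn.
  rewrite gn dot_site// mulrC ltr_pdivrMr// in dn.
  rewrite -(ltr_nat R) natrM mulrC -ltr_pdivlMr ?ltr0n// mulrC.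
  apply: le_lt_trans dn.
  by rewrite -[b%:R]/((b%:Z)%:~R) ler_int lerDr.
have Mb' : (2 * (q * b) + 2 * b < n)%N by move: Mb; rewrite /M; lia.
have aN : (N.+1 <= a)%N by lia.
have qa : (q * b <= a)%N by lia.
have := turn (leq_trans (ltn0Sn N) aN); rewrite leNgt qN//.
exact: ltnW.
Qed.

End Straight.

(** * The theorem *)

Section Reindex.
Context d (T : measurableType d) (R : realType) (P : probability T R).

Lemma indep_family_inj (I J : choiceType) (X : I -> T -> R) (f : J -> I) :
  injective f -> indep_family P X -> indep_family P (fun j => X (f j)).
Proof.
move=> fI [mX indX]; split=> // s B us mB.
case: s us => [|j0 s] us; first by rewrite set_nil bigcap_set0 big_nil; exact: probability_setT.
set s' := j0 :: s in us *.
pose B' i := B (nth j0 s' (index i (map f s'))).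
have B'E j : j \in s' -> B' (f j) = B j.
  by move=> js; rewrite /B' index_map// nth_index.
have us' : uniq (map f s') by rewrite map_inj_uniq.
rewrite (_ : \bigcap_(j in [set` s']) (X (f j) @^-1` B j) =
  \bigcap_(i in [set` map f s']) (X i @^-1` B' i)); last first.
  apply/seteqP; split => t h.
    move=> l /= ls; have [j js ->] : exists2 j, j \in s' & l = f j by exact/seq.mapP.
    by rewrite /= B'E//; exact: h.
  by move=> j /= js; rewrite -B'E//; apply: h; exact: (seq.map_f f js).
have mB' l : measurable (B' l) by exact: mB.
by rewrite indX// big_map; apply: eq_big_seq => j js; rewrite B'E.
Qed.

Lemma indep_exp_site (omega : int * int -> {RV P >-> R}) x i :
  iid_exponential 1 omega ->
  indep_exp P (fun=> 1) (fun z : nat * nat => (omega (site x i z.1 z.2) : T -> R)).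
Proof.
move=> [ind law]; split; last by move=> z B mB; exact: law.
apply: (@indep_family_inj _ _ (fun z => (omega z : T -> R))
  (fun z : nat * nat => site x i z.1 z.2)).
  by move=> [a b] [a' b'] /= /site_inj[-> ->].
by split => // s B us mB; exact: ind.
Qed.

End Reindex.

Theorem theorem2p2 (d : measure_display) (T : measurableType d) (R : realType)
    (P : probability T R) (omega : int * int -> {RV P >-> R})
    (omega_iid : iid_exponential 1 omega) :
  {ae P, forall t : T,
    forall (i : nat) (x : int * int),
      i \in [:: 1%N; 2%N] -> 0 <= x.1 -> 0 <= x.2 ->
      forall g : nat -> int * int,
        [/\ semi_infinite_geodesic (fun z => omega z t) g,
            g 0%N = x &
            limn_einf (fun k : nat =>
              (k%:R^-1 * (dot (g k) (basis_vec (3 - i)))%:~R : R)%:E) = 0%E]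
        <-> g = (fun k : nat => x + basis_vec i *+ k)}.
Proof.
have right : {ae P, forall t, forall n, forall i y, unpickle n = Some (i, y) ->
   exists q N, forall a b, (N <= a)%N -> (0 < b)%N -> (q * b <= a)%N ->
     lpp (fun a b => omega (site y i a b) t) a b 0 1 <
     lpp (fun a b => omega (site y i a b) t) a b 1 0}.
  apply/ae_foralln => n.
  case: (unpickle n : option (nat * (int * int))) => [[i y]|]; last exact: nearW.
  have := ae_goes_right (indep_exp_site y i omega_iid).
  by apply: filterS => t right _ _ [<- <-].
apply: filterS right => t right i x iP x1 x2 g; split.
  move=> [geo g0 ginf]; apply: geodesic_straight geo g0 ginf => // y.
  by apply: (right (pickle (i, y))); rewrite pickleK.
move=> ->; split.
- exact: straight_geodesic.
- by rewrite mulr0n addr0.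
- exact: ray_limn_einf.
Qed.
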